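(* Let $(M,H)$ be an $n$-dimensional Carnot manifold of step $r$ with weight sequence $(w_1,\ldots,w_n)$, let $a\in M$, and let $(x_1,\ldots,x_n)$ be local coordinates centered at $a$, over whose domain there is an $H$-frame $(X_1,\ldots,X_n)$, and which are linearly adapted at $a$ to $(X_1,\ldots,X_n)$. Let $U\subset\mathbb{R}^n$ be the range of these coordinates, and regard the $X_j$ as vector fields on $U$. Then the following are equivalent: (i) The local coordinates $(x_1,\ldots,x_n)$ are privileged coordinates at $a$ adapted to $(X_1,\ldots,X_n)$. (ii) For $j=1,\ldots,n$ and as $t\to 0$, we have $t^{w_j}\delta_t^*X_j=X_j^{(a)}+\operatorname{O}(t)$ in $\mathcal{X}(U)$, where $X_j^{(a)}$ is a vector field on $\mathbb{R}^n$ which is homogeneous of degree $-w_j$. (iii) For $j=1,\ldots,n$, the vector field $X_j$ has weight $-w_j$ in the local coordinates $(x_1,\ldots,x_n)$. (iv) For every multi-order $\alpha\in\mathbb{N}_0^n$, the differential operator $X^\alpha=X_1^{\alpha_1}\cdots X_n^{\alpha_n}$ has weight $-\langle\alpha\rangle$ in the local coordinates $(x_1,\ldots,x_n)$.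
   Context: Carnot manifolds. A Carnot manifold of step $r$ is a pair $(M,H)$, where $M$ is a smooth manifold and $H=(H_1,\ldots,H_r)$ is a filtration of subbundles $H_1\subset\cdots\subset H_r=TM$ such that Lie brackets of sections of $H_w$ and $H_{w'}$ are sections of $H_{w+w'}$ whenever $w+w'\le r$. With $n=\dim M$, its weight sequence is $w_j=\min\{w\in\{1,\ldots,r\}:\ j\le\operatorname{rk}H_w\}$, $j=1,\ldots,n$. An $H$-frame over an open set is a tangent frame $(X_1,\ldots,X_n)$ such that each $X_j$ is a section of $H_{w_j}$. Order. For a finite sequence $I=(i_1,\ldots,i_k)$ in $\{1,\ldots,n\}$ set $X_I=X_{i_1}\cdots X_{i_k}$ and $\langle I\rangle=w_{i_1}+\cdots+w_{i_k}$. A smooth function $f$ near $a$ has order $\ge N$ at $a$ ($N$ a non-negative integer) if $X_If(a)=0$ whenever $\langle I\rangle<N$; it has order $N$ if moreover $X_If(a)\neq0$ for some $I$ with $\langle I\rangle=N$. Privileged coordinates. Local coordinates centered at $a$ are linearly adapted at $a$ to $(X_1,\ldots,X_n)$ if $X_j(0)=\partial_j$ for all $j$. They are privileged coordinates at $a$ adapted to $(X_1,\ldots,X_n)$ if they are linearly adapted and each coordinate function $x_k$ has order $w_k$ at $a$. Dilations and weight. For $\alpha\in\mathbb{N}_0^n$ set $\langle\alpha\rangle=w_1\alpha_1+\cdots+w_n\alpha_n$. Set $\delta_t(x)=t\cdot x=(t^{w_1}x_1,\ldots,t^{w_n}x_n)$. For $t\ne0$ and a differential operator $P$ on $U$, $\delta_t^*P$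 is the operator on $\delta_t^{-1}(U)$ given by $(\delta_t^*P)u(x)=P(u\circ\delta_t^{-1})(t\cdot x)$. An operator $P$ on $\mathbb{R}^n$ is homogeneous of degree $w\in\mathbb{Z}$ if $\delta_t^*P=t^wP$ for all $t\in\mathbb{R}\setminus\{0\}$. A smooth function $f$ near $0$ has weight $\ge w$ if $\partial^\alpha f(0)=0$ for all $\alpha$ with $\langle\alpha\rangle<w$; it has weight $w$ if moreover $\partial^\alpha f(0)\ne0$ for some $\alpha$ with $\langle\alpha\rangle=w$. A differential operator $P=\sum_{|\alpha|\le m}a_\alpha(x)\partial_x^\alpha$ has weight $w\in\mathbb{Z}$ if each $a_\alpha$ has weight $\ge w+\langle\alpha\rangle$, and at least one $a_\alpha$ has weight exactly $w+\langle\alpha\rangle$. Vector fields are regarded as first-order differential operators. Topology. $\mathcal{X}(U)$ is the space of smooth vector fields on $U$ with the topology of uniform convergence on compact subsets of $U$ of all derivatives of the coefficients. For each compact $K\subset U$, $\delta_t^*X_j$ is defined near $K$ for $t\neq 0$ small, and $\operatorname{O}(t)$ in $\mathcal{X}(U)$ means that each seminorm (sup over $K$ of a given derivative of the coefficients) is $\operatorname{O}(t)$. *)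

(* Defs.v *)
From mathcomp Require Import all_boot all_order all_algebra.
From mathcomp Require Import all_classical all_reals all_analysis.
Set Implicit Arguments.
Unset Strict Implicit.
Unset Printing Implicit Defensive.
Import Order.TTheory GRing.Theory Num.Theory numFieldNormedType.Exports.
Local Open Scope classical_set_scope.
Local Open Scope ring_scope.

(* [foldr (fun i g => D i g) f [:: i1; ..; ik]] is [D i1 (.. (D ik f))]. *)
Definition iter_seq (n : nat) (F : Type) (D : 'I_n -> F -> F)
    (I : seq 'I_n) (f : F) : F := foldr D f I.

Definition multi (n : nat) := {ffun 'I_n -> nat}.

(* D_1^{al_1} ... D_n^{al_n} f; used both for \partial^al and for X^al. *)
Definition iter_multi (n : nat) (F : Type) (D : 'I_n -> F -> F)
    (al : multi n) (f : F) : F :=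
  foldr (fun i g => iter (al i) (D i) g) f (enum 'I_n).

Definition mlen (n : nat) (al : multi n) : nat := (\sum_i al i)%N.

(** * Smooth functions on open subsets of R^n *)

Definition partial (R : realType) (n : nat) (i : 'I_n)
    (f : 'rV[R]_n -> R) : 'rV[R]_n -> R :=
  fun x => 'D_(delta_mx 0 i) f x.

(* Meant for [U] open: f and all its iterated partial derivatives are
   (Frechet) differentiable at every point of U. *)
Definition smooth_on (R : realType) (n : nat) (U : set 'rV[R]_n)
    (f : 'rV[R]_n -> R) : Prop :=
  forall (I : seq 'I_n) (x : 'rV[R]_n), U x ->
    differentiable (iter_seq (@partial R n) I f) x.

Definition smooth_map (R : realType) (m n : nat) (U : set 'rV[R]_m)
    (f : 'rV[R]_m -> 'rV[R]_n) : Prop :=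
  forall k : 'I_n, smooth_on U (fun x => f x 0 k).

(** * Smooth manifolds *)

Record chart (R : realType) (n : nat) (M : topologicalType) := Chart {
  dom : set M;
  rng : set 'rV[R]_n;
  fwd :> M -> 'rV[R]_n;
  bwd : 'rV[R]_n -> M;
  dom_open : open dom;
  rng_open : open rng;
  fwd_rng : forall p, dom p -> rng (fwd p);
  bwd_dom : forall x, rng x -> dom (bwd x);
  fwdK : forall p, dom p -> bwd (fwd p) = p;
  bwdK : forall x, rng x -> fwd (bwd x) = x;
  fwd_continuous : forall p, dom p -> {for p, continuous fwd};
  bwd_continuous : forall x, rng x -> {for x, continuous bwd} }.

Definition compatible (R : realType) (n : nat) (M : topologicalType)
    (c d : chart R n M) : Prop :=
  smooth_map (c @` (dom c `&` dom d)) (d \o bwd c) /\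
  smooth_map (d @` (dom c `&` dom d)) (c \o bwd d).

(* [chart_at p] is a chosen chart of the atlas around p.  It serves only to
   represent the tangent space T_pM by 'rV[R]_n: a tangent vector at p is given
   by its components in the chart [chart_at p]. *)
Record manifold (R : realType) (n : nat) (M : topologicalType) := Manifold {
  atlas : set (chart R n M);
  chart_at : M -> chart R n M;
  chart_at_atlas : forall p, atlas (chart_at p);
  chart_at_dom : forall p, dom (chart_at p) p;
  atlas_compatible : forall c d, atlas c -> atlas d -> compatible c d;
  manifold_hausdorff : hausdorff_space M;
  manifold_second_countable : @second_countable M }.

Definition local_coordinates (R : realType) (n : nat) (M : topologicalType)
    (S : manifold R n M) (phi : chart R n M) : Prop :=
  forall c, atlas S c -> compatible phi c.

Definition centered_at (R : realType) (n : nat) (M : topologicalType)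
    (phi : chart R n M) (a : M) : Prop :=
  dom phi a /\ phi a = 0.

(* Tangent vectors at p are represented as explained above [manifold], hence
   X : M -> 'rV[R]_n.  [vder S X f p] is the derivative of f at p along X p,
   for f with values in R or, componentwise, in R^n. *)
Definition vder (R : realType) (n : nat) (M : topologicalType)
    (S : manifold R n M) (V : normedModType R)
    (X : M -> 'rV[R]_n) (f : M -> V) : M -> V :=
  fun p => 'D_(X p) (f \o bwd (chart_at S p)) (chart_at S p p).

(* The vector field X in the coordinates c: its k-th component is X(c_k). *)
Definition vf_in (R : realType) (n : nat) (M : topologicalType)
    (S : manifold R n M) (c : chart R n M) (X : M -> 'rV[R]_n)
    : 'rV[R]_n -> 'rV[R]_n :=
  fun x => vder S X (fwd c) (bwd c x).

Definition smooth_vf (R : realType) (n : nat) (M : topologicalType)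
    (S : manifold R n M) (V : set M) (X : M -> 'rV[R]_n) : Prop :=
  forall c, atlas S c -> smooth_map (c @` (dom c `&` V)) (vf_in S c X).

(* The k-th component of [X, Y] at p in the chart c = chart_at p is
   X(Y(c_k)) - Y(X(c_k)). *)
Definition lie_bracket (R : realType) (n : nat) (M : topologicalType)
    (S : manifold R n M) (X Y : M -> 'rV[R]_n) : M -> 'rV[R]_n :=
  fun p => vder S X (vder S Y (fwd (chart_at S p))) p
         - vder S Y (vder S X (fwd (chart_at S p))) p.

(** * Carnot manifolds *)

Definition smooth_subbundle (R : realType) (n : nat) (M : topologicalType)
    (S : manifold R n M) (m : nat) (E : M -> {vspace 'rV[R]_n}) : Prop :=
  forall p : M, exists (V : set M) (Y : 'I_m -> M -> 'rV[R]_n),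
    [/\ open V, V p, forall i, smooth_vf S V (Y i)
      & forall q, V q -> basis_of (E q) [seq Y i q | i <- enum 'I_m]].

Definition section_of (R : realType) (n : nat) (M : topologicalType)
    (S : manifold R n M) (E : M -> {vspace 'rV[R]_n}) (V : set M)
    (X : M -> 'rV[R]_n) : Prop :=
  smooth_vf S V X /\ forall p, V p -> X p \in E p.

(* Only H_1, ..., H_r are meaningful. *)
Record carnot (R : realType) (n : nat) (M : topologicalType)
    (S : manifold R n M) (r : nat) := Carnot {
  filt :> nat -> M -> {vspace 'rV[R]_n};
  rk : nat -> nat;
  carnot_step : (0 < r)%N;
  filt_subbundle : forall w, (0 < w <= r)%N ->
    smooth_subbundle S (rk w) (filt w);
  filt_sub : forall w w' p, (0 < w)%N -> (w <= w' <= r)%N ->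
    (filt w p <= filt w' p)%VS;
  filt_top : forall p, filt r p = fullv;
  filt_bracket : forall w w' (V : set M) (X Y : M -> 'rV[R]_n),
    (0 < w)%N -> (0 < w')%N -> (w + w' <= r)%N -> open V ->
    section_of S (filt w) V X -> section_of S (filt w') V Y ->
    forall p, V p -> lie_bracket S X Y p \in filt (w + w') p }.

(* The least w in {1, ..., r} with j + 1 <= rk H_w (j is 0-based). *)
Definition weight_seq (R : realType) (n : nat) (M : topologicalType)
    (S : manifold R n M) (r : nat) (H : carnot S r) (j : 'I_n) : nat :=
  (find (fun w => (j < rk H w)%N) (iota 1 r)).+1.

Definition H_frame (R : realType) (n : nat) (M : topologicalType)
    (S : manifold R n M) (r : nat) (H : carnot S r) (V : set M)
    (X : 'I_n -> M -> 'rV[R]_n) : Prop :=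
  (forall j, section_of S (H (weight_seq H j)) V (X j)) /\
  (forall p, V p -> basis_of fullv [seq X j p | j <- enum 'I_n]).

(** * Order and privileged coordinates *)

Definition seq_weight (n : nat) (w : 'I_n -> nat) (I : seq 'I_n) : nat :=
  (\sum_(i <- I) w i)%N.

Definition order_ge (R : realType) (n : nat) (M : topologicalType)
    (S : manifold R n M) (w : 'I_n -> nat) (X : 'I_n -> M -> 'rV[R]_n)
    (f : M -> R) (a : M) (N : nat) : Prop :=
  forall I : seq 'I_n, (seq_weight w I < N)%N ->
    iter_seq (fun i => vder S (X i)) I f a = 0.

Definition has_order (R : realType) (n : nat) (M : topologicalType)
    (S : manifold R n M) (w : 'I_n -> nat) (X : 'I_n -> M -> 'rV[R]_n)
    (f : M -> R) (a : M) (N : nat) : Prop :=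
  order_ge S w X f a N /\
  exists2 I : seq 'I_n, seq_weight w I = N &
    iter_seq (fun i => vder S (X i)) I f a != 0.

(* For coordinates centered at a, the point a corresponds to 0. *)
Definition linearly_adapted (R : realType) (n : nat) (M : topologicalType)
    (S : manifold R n M) (phi : chart R n M) (X : 'I_n -> M -> 'rV[R]_n)
    : Prop :=
  forall j, vf_in S phi (X j) 0 = delta_mx 0 j.

Definition privileged (R : realType) (n : nat) (M : topologicalType)
    (S : manifold R n M) (w : 'I_n -> nat) (phi : chart R n M) (a : M)
    (X : 'I_n -> M -> 'rV[R]_n) : Prop :=
  linearly_adapted S phi X /\
  forall k, has_order S w X (fun p => phi p 0 k) a (w k).

(** * Weights, differential operators and dilations on R^n *)

Definition multi_weight (n : nat) (w : 'I_n -> nat) (al : multi n) : nat :=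
  (\sum_i w i * al i)%N.

Definition weight_ge (R : realType) (n : nat) (w : 'I_n -> nat)
    (f : 'rV[R]_n -> R) (v : int) : Prop :=
  forall al : multi n, (multi_weight w al)%:Z < v ->
    iter_multi (@partial R n) al f 0 = 0.

Definition has_weight (R : realType) (n : nat) (w : 'I_n -> nat)
    (f : 'rV[R]_n -> R) (v : int) : Prop :=
  weight_ge w f v /\
  exists2 al : multi n, (multi_weight w al)%:Z = v &
    iter_multi (@partial R n) al f 0 != 0.

Definition operator (R : realType) (n : nat) :=
  ('rV[R]_n -> R) -> 'rV[R]_n -> R.

(* P = \sum_(|al| <= m) a_al \partial^al on U, with smooth coefficients.  The
   sum ranges over functions into {0, .., m} so as to be syntactically finite;
   |al| <= m forces each al_i <= m. *)
Definition is_diffop (R : realType) (n : nat) (U : set 'rV[R]_n)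
    (P : operator R n) (m : nat) (a : multi n -> 'rV[R]_n -> R) : Prop :=
  (forall al, smooth_on U (a al)) /\
  forall u, smooth_on U u -> forall x, U x ->
    P u x = \sum_(be : {ffun 'I_n -> 'I_m.+1} | (\sum_i be i <= m)%N)
      let al : multi n := [ffun i => nat_of_ord (be i)] in
      a al x * iter_multi (@partial R n) al u x.

(* On an open set the coefficients are determined by the operator. *)
Definition diffop_weight (R : realType) (n : nat) (w : 'I_n -> nat)
    (U : set 'rV[R]_n) (P : operator R n) (v : int) : Prop :=
  exists (m : nat) (a : multi n -> 'rV[R]_n -> R),
    [/\ is_diffop U P m a,
        forall al, (mlen al <= m)%N ->
          weight_ge w (a al) (v + (multi_weight w al)%:Z)
      & exists2 al, (mlen al <= m)%N &
          has_weight w (a al) (v + (multi_weight w al)%:Z)].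

Definition vf_op (R : realType) (n : nat) (Y : 'rV[R]_n -> 'rV[R]_n)
    : operator R n :=
  fun u x => \sum_k Y x 0 k * partial k u x.

Definition dil (R : realType) (n : nat) (w : 'I_n -> nat) (t : R)
    (x : 'rV[R]_n) : 'rV[R]_n :=
  \row_i (t ^+ w i * x 0 i).

(* delta_t^* P, for t != 0; the inverse of delta_t is delta_(1/t). *)
Definition pull_op (R : realType) (n : nat) (w : 'I_n -> nat) (t : R)
    (P : operator R n) : operator R n :=
  fun u x => P (u \o dil w t^-1) (dil w t x).

(* The vector field delta_t^* Y: its k-th coefficient is its value on the k-th
   coordinate function. *)
Definition pull_vf (R : realType) (n : nat) (w : 'I_n -> nat) (t : R)
    (Y : 'rV[R]_n -> 'rV[R]_n) : 'rV[R]_n -> 'rV[R]_n :=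
  fun x => \row_k pull_op w t (vf_op Y) (fun y => y 0 k) x.

Definition homogeneous (R : realType) (n : nat) (w : 'I_n -> nat)
    (P : operator R n) (d : int) : Prop :=
  forall t : R, t != 0 -> forall u, smooth_on setT u -> forall x,
    pull_op w t P u x = t ^ d * P u x.

(* F t = O(t) in \mathcal{X}(U) as t -> 0, t != 0. *)
Definition vf_bigO (R : realType) (n : nat) (U : set 'rV[R]_n)
    (F : R -> 'rV[R]_n -> 'rV[R]_n) : Prop :=
  forall K : set 'rV[R]_n, compact K -> K `<=` U ->
  forall (al : multi n) (k : 'I_n), exists C : R, \forall t \near 0^',
    forall x, K x ->
      `|iter_multi (@partial R n) al (fun y => F t y 0 k) x| <= C * `|t|.

(* Main.v *)
(* In the coordinates the Carnot structure only enters through the weights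
   [w_i >= 1] and the smooth fields [Y_j], with [Y_j(0) = \partial_j].  Call
   "order >= N with respect to D_1, .., D_n" the vanishing at 0 of [D_I f] for
   all [I] of weight < N: for [D_i = Y_i] this is the order, for
   [D_i = \partial_i] it is the weight, because partial derivatives commute.
   All four conditions amount to

     ( * )  the k-th coefficient [Y_jk] of [Y_j] has weight >= w_k - w_j.

   - (i) gives [Y_jk = Y_j x_k] Y-order >= w_k - w_j.  In
     [\partial_j f = Y_j f - \sum_k (Y_jk - delta_jk) \partial_k f] the
     coefficients have Y-order >= max(1, w_k - w_j), so an induction shows that
     [\partial_j] lowers the Y-order by at most w_j; hence Y-order bounds
     weight from below, and ( * ) follows.
   - ( * ) gives (ii): if [f] has weight >= N then
     [f(\delta_t x) = t^N f_N(x) + O(t^(N+1))] on compact sets, and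
     [\partial_j (f_N) = (\partial_j f)_(N - w_j)] transfers the estimate to
     all derivatives.  Conversely, the derivatives at 0 of the rescaled field
     are [t^(w_j - w_k + <al>) \partial^al Y_jk(0)]; they stay bounded only
     under ( * ).
   - ( * ) gives (iii) and (iv): expanding, [Y_I] is [\partial_I] plus terms
     [c \partial_J] with [c] of weight >= <J> - <I>, and [c(0) = 0] if J is as
     long as I; so the coefficient of [\partial_I] is 1 at 0.
   - An operator of weight -v lowers weights by at most v.  With (iii), applied
     to [x_k], this gives ( * ), then that [Y_I x_k] has weight >= w_k - <I>,
     which is (i). *)
Require Import Defs.
From mathcomp Require Import all_boot all_order all_algebra.
From mathcomp Require Import all_classical all_reals all_analysis.
From mathcomp Require Import ring lra zify.
Set Implicit Arguments.
Unset Strict Implicit.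
Unset Printing Implicit Defensive.
Import Order.TTheory GRing.Theory Num.Theory numFieldNormedType.Exports.
Local Open Scope classical_set_scope.
Local Open Scope ring_scope.

Lemma derive_comp (R : realType) (V W W' : normedModType R) (f : V -> W)
    (h : W -> W') x v :
  differentiable f x -> differentiable h (f x) ->
  'D_v (h \o f) x = 'D_('D_v f x) h (f x).
Proof.
move=> df dh; rewrite (deriveE _ (differentiable_comp df dh)) (deriveE _ dh).
by rewrite (deriveE _ df) diff_comp.
Qed.

(** * Calculus in several variables *)

Section Calculus.
Variables (R : realType) (V : normedModType R).

Lemma differentiable_row n (f : V -> 'rV[R]_n) x :
  (forall k, differentiable (fun y => f y 0 k) x) -> differentiable f x.
Proof.
move=> df.
have -> : f = \sum_(k < n) (fun y => f y 0 k *: (delta_mx 0 k : 'rV[R]_n)).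
  by apply/funext => y; rewrite fct_sumE -row_sum_delta.
by apply: differentiable_sum => k; exact: differentiableZl.
Qed.

Lemma derive_row n (f : V -> 'rV[R]_n) x v k : differentiable f x ->
  'D_v f x 0 k = 'D_v (fun y => f y 0 k) x.
Proof. by move=> df; rewrite derive_mx ?mxE//; exact: diff_derivable. Qed.

Lemma derive_partial n (h : 'rV[R]_n -> R) x v : differentiable h x ->
  'D_v h x = \sum_k v 0 k * partial k h x.
Proof.
move=> dh; rewrite deriveE// {1}(row_sum_delta v) linear_sum.
by apply: eq_bigr => k _; rewrite linearZ /partial deriveE.
Qed.

Lemma derive_comp_row n (f : V -> 'rV[R]_n) (h : 'rV[R]_n -> R) x v :
  (forall k, differentiable (fun y => f y 0 k) x) -> differentiable h (f x) ->
  'D_v (h \o f) x = \sum_k 'D_v (fun y => f y 0 k) x * partial k h (f x).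
Proof.
move=> df dh; have df' := differentiable_row df.
rewrite (derive_comp _ df' dh) derive_partial//.
by apply: eq_bigr => k _; rewrite derive_row.
Qed.

Lemma mvt_line (f : V -> R) x v t : 0 <= t ->
  (forall s, 0 <= s <= t -> differentiable f (x + s *: v)) ->
  exists2 s, 0 <= s <= t & f (x + t *: v) - f x = t * 'D_v f (x + s *: v).
Proof.
move=> t0 df; pose g s := f (x + s *: v).
have dl s : is_diff s (fun s : R => x + s *: v) (fun s : R => s *: v).
  by apply: is_diff_eq; rewrite add0r.
have dg s : 0 <= s <= t -> is_derive s 1 g ('D_v f (x + s *: v)).
  move=> /df dfs; have [ds dsE] := dl s; apply: DeriveDef.
    exact: diff_derivable (differentiable_comp ds dfs).
  have -> : g = f \o (fun s : R => x + s *: v) by [].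
  by rewrite (derive_comp _ ds dfs) (deriveE _ ds) dsE scale1r.
have [s||s] := @MVT_segment R g (fun s => 'D_v f (x + s *: v)) 0 t t0.
- by rewrite in_itv/= => /andP[s0 st]; apply: dg; rewrite (ltW s0) ltW.
- apply: derivable_within_continuous => s; rewrite in_itv/= => /dg sg.
  exact: ex_derive.
- rewrite in_itv/= => s0t; rewrite /g scale0r addr0 subr0 mulrC => ->.
  by exists s.
Qed.

End Calculus.

Lemma norm_delta_le1 (R : realType) n (i : 'I_n) :
  `|delta_mx 0 i : 'rV[R]_n| <= 1.
Proof.
rewrite [leLHS]/Num.Def.normr/= mx_normrE; apply: bigmax_le => //= -[a b] _.
by rewrite mxE; case: (_ && _); rewrite ?normr1 ?normr0.
Qed.

Lemma norm_coord_le (R : realType) n (x : 'rV[R]_n) k : `|x 0 k| <= `|x|.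
Proof.
rewrite [leRHS]/Num.Def.normr/= mx_normrE.
exact: (le_bigmax _ (fun i : 'I_1 * 'I_n => `|x i.1 i.2|) (0, k)).
Qed.

Lemma norm_row_le (R : realType) n (x : 'rV[R]_n) C : 0 <= C ->
  (forall k, `|x 0 k| <= C) -> `|x| <= C.
Proof.
move=> C0 h; rewrite [leLHS]/Num.Def.normr/= mx_normrE.
by apply: bigmax_le => //= -[a b] _ /=; rewrite (ord1 a).
Qed.

Lemma ltr_dist_near (R : realType) (a b z r : R) :
  `|a - z| < r -> `|b - z| < r -> `|a - b| < r + r.
Proof.
by rewrite (distrC b) => az bz; rewrite (le_lt_trans (ler_distD z a b))// ltrD.
Qed.

(** * Symmetry of second derivatives *)

Section Schwarz.
Variables (R : realType) (V : normedModType R).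

(** The mean value theorem is used twice: in direction [u] for [g y = f (y + t *: v) - f y], then in
    direction [v] for ['D_u f]. The bound [t + t < d] keeps the whole parallelogram inside the
    ball. *)
Lemma second_difference (f : V -> R) (x u v : V) (d t : R) :
  `|u| <= 1 -> `|v| <= 1 -> 0 <= t -> t + t < d ->
  (forall y, ball x d y -> differentiable f y) ->
  (forall y, ball x d y -> differentiable (fun z => 'D_u f z) y) ->
  exists2 y, ball x d y &
    f (x + t *: u + t *: v) - f (x + t *: u) - f (x + t *: v) + f x
    = t * t * 'D_v (fun z => 'D_u f z) y.
Proof.
move=> u1 v1 t0 td df ddf.
have inb a b : 0 <= a <= t -> 0 <= b <= t -> ball x d (x + a *: u + b *: v).
  move=> /andP[a0 at_] /andP[b0 bt].
  rewrite -ball_normE/= -addrA opprD addrA subrr add0r normrN.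
  apply: le_lt_trans td; apply: le_trans (ler_normD _ _) _.
  rewrite !normrZ !ger0_norm//; apply: lerD.
    by rewrite (le_trans (ler_piMr _ _)).
  by rewrite (le_trans (ler_piMr _ _)).
have tt : 0 <= t <= t by rewrite t0 lexx.
have zt : 0 <= (0 : R) <= t by rewrite t0 lexx.
pose g y := f (y + t *: v) - f y.
have dsh (y : V) : is_diff y (fun z => z + t *: v) id.
  by apply: is_diff_eq; rewrite addr0.
have dg1 s : 0 <= s <= t ->
    differentiable (f \o (fun z => z + t *: v)) (x + s *: u).
  move=> st; apply: differentiable_comp; last exact/df/inb.
  by have [] := dsh (x + s *: u).
have inb0 a : 0 <= a <= t -> ball x d (x + a *: u).
  by move=> st; have := inb _ _ st zt; rewrite scale0r addr0.
have [s st sE] : exists2 s, 0 <= s <= t &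
    g (x + t *: u) - g x = t * 'D_u g (x + s *: u).
  apply: mvt_line => // s st.
  by apply: (@differentiableB _ _ _ (f \o (fun z => z + t *: v)));
    [exact: dg1|exact/df/inb0].
have gE : 'D_u g (x + s *: u)
    = 'D_u f (x + s *: u + t *: v) - 'D_u f (x + s *: u).
  rewrite (@deriveB _ _ _ (f \o (fun z => z + t *: v))); first last.
  - exact/diff_derivable/df/inb0.
  - exact/diff_derivable/dg1.
  have [ds dsE] := dsh (x + s *: u); congr (_ - _).
  by rewrite (derive_comp _ ds (df _ (inb _ _ st tt))) (deriveE _ ds) dsE.
have [s' s't s'E] : exists2 s', 0 <= s' <= t &
    'D_u f (x + s *: u + t *: v) - 'D_u f (x + s *: u)
    = t * 'D_v (fun z => 'D_u f z) (x + s *: u + s' *: v).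
  apply: (@mvt_line R V (fun z => 'D_u f z) (x + s *: u) v t t0) => s' s't.
  by apply: ddf; exact: inb.
exists (x + s *: u + s' *: v); first exact: inb.
by rewrite -mulrA -s'E -gE -sE /g; ring.
Qed.

(** The second difference is symmetric in [u] and [v], so the two mixed derivatives take a common
    value, at two points arbitrarily close to [x]. If they differed at [x], continuity with margin
    half their distance would be contradicted. *)
Lemma derive_swap (f : V -> R) (x u v : V) (d : R) : 0 < d ->
  `|u| <= 1 -> `|v| <= 1 ->
  (forall y, ball x d y -> differentiable f y) ->
  (forall y, ball x d y -> differentiable (fun z => 'D_u f z) y) ->
  (forall y, ball x d y -> differentiable (fun z => 'D_v f z) y) ->
  {for x, continuous (fun z => 'D_u (fun z => 'D_v f z) z)} ->
  {for x, continuous (fun z => 'D_v (fun z => 'D_u f z) z)} ->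
  'D_u (fun z => 'D_v f z) x = 'D_v (fun z => 'D_u f z) x.
Proof.
move=> d0 u1 v1 df du dv cuv cvu; apply/eqP/negPn/negP => ne.
set A := 'D_u _ x in ne *; set B := 'D_v _ x in ne *.
pose e := `|A - B| / 2.
have e0 : 0 < e by rewrite divr_gt0 // normr_gt0 subr_eq0.
have /cvgrPdist_lt /(_ _ e0) /nbhs_ballP[/= d1 d1_gt0 h1] := cuv.
have /cvgrPdist_lt /(_ _ e0) /nbhs_ballP[/= d2 d2_gt0 h2] := cvu.
pose m := Num.min d (Num.min d1 d2).
have m0 : 0 < m by rewrite /m !lt_min d0 d1_gt0 d2_gt0.
have md : m <= d by rewrite /m ge_min lexx.
have md1 : m <= d1 by rewrite /m !ge_min lexx orbT.
have md2 : m <= d2 by rewrite /m !ge_min lexx !orbT.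
pose t := m / 4.
have t0 : 0 < t by rewrite divr_gt0.
have tm : t + t < m by rewrite /t; lra.
have sub y : ball x m y -> ball x d y by apply: le_ball.
have [y1 y1m E1] := second_difference u1 v1 (ltW t0) tm
  (fun y yb => df _ (sub _ yb)) (fun y yb => du _ (sub _ yb)).
have [y2 y2m E2] := second_difference v1 u1 (ltW t0) tm
  (fun y yb => df _ (sub _ yb)) (fun y yb => dv _ (sub _ yb)).
(* Both sides times [t * t] are the same second difference, up to the order of its terms. *)
have E : 'D_v (fun z => 'D_u f z) y1 = 'D_u (fun z => 'D_v f z) y2.
  apply: (mulfI (lt0r_neq0 (mulr_gt0 t0 t0))).
  apply: etrans (esym E1) _; apply: etrans _ E2; rewrite (addrAC x).
  by rewrite [X in X + _ = _]addrAC.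
have := h2 _ (le_ball md2 y1m); rewrite /= E => Bz.
have := ltr_dist_near (h1 _ (le_ball md1 y2m)) Bz.
by rewrite -/A -/B /e -splitr ltxx.
Qed.

End Schwarz.

(** * Smooth functions on open sets *)

Definition eq_on (T S : Type) (U : set T) (f g : T -> S) : Prop :=
  forall x, U x -> f x = g x.

Section Smooth.
Variables (R : realType) (n : nat).
Local Notation F := ('rV[R]_n -> R).
Implicit Types (U : set 'rV[R]_n) (f g : F).

Lemma iter_seq_rcons (D : 'I_n -> F -> F) I i f :
  iter_seq D (rcons I i) f = iter_seq D I (D i f).
Proof. by rewrite /iter_seq foldr_rcons. Qed.

Lemma iter_seq_cat (D : 'I_n -> F -> F) I J f :
  iter_seq D (I ++ J) f = iter_seq D I (iter_seq D J f).
Proof. by rewrite /iter_seq foldr_cat. Qed.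

Lemma eq_on_near U f g x : open U -> U x -> eq_on U f g ->
  {near x, f =1 g}.
Proof.
move=> oU Ux fg; near=> y; apply: fg; near: y; exact: open_nbhs_nbhs.
Unshelve. all: by end_near. Qed.

(** The differential is chosen among the first-order expansions, so its locality needs an argument:
    the expansion of [f] is also one of [g], and uniqueness then identifies the differential of
    [g]. *)
Lemma differentiable_eq_on (V W : normedModType R) (U : set V) (f g : V -> W) x :
  open U -> U x -> eq_on U f g -> differentiable f x -> differentiable g x.
Proof.
move=> oU Ux fg df; have fgx : \forall y \near x, f y = g y.
  by near=> y; apply: fg; near: y; exact: open_nbhs_nbhs.
have E : g \o shift x = cst (g x) + 'd f x +o_ 0 id.
  apply/eqaddoP => e e0; have /eqaddoP /(_ e e0) := diff_locally df.
  have : \forall h \near (0 : V), f (h + x) = g (h + x).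
    by have := fgx; rewrite (near_shift 0 x) subr0.
  by apply: filterS2 => h fgh; rewrite /= !fctE -fgh (fg x Ux).
apply/diff_locallyP; rewrite (diff_unique (diff_continuous df) E).
by split=> //; exact: diff_continuous.
Unshelve. all: by end_near. Qed.

Lemma partial_eq_on U f g i : open U -> eq_on U f g ->
  eq_on U (partial i f) (partial i g).
Proof.
by move=> oU fg x Ux; apply: near_eq_derive; exact: eq_on_near oU Ux fg.
Qed.

(** A finite-order version of [smooth_on], made for induction on [m]: the derivative of a product
    again involves the factors themselves, which [diffnS] supplies at the smaller order. *)
Fixpoint diffn U m f : Prop :=
  (forall x, U x -> differentiable f x) /\
  if m is m'.+1 then forall i, diffn U m' (partial i f) else True.

Lemma diffn_diff U m f x : diffn U m f -> U x -> differentiable f x.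
Proof. by case: m => [|m] [h _]; exact: h. Qed.

Lemma diffnS U m f : diffn U m.+1 f -> diffn U m f.
Proof.
elim: m f => [|m IH] f [df h]; split=> // i; exact/IH/h.
Qed.

Lemma smooth_diffn U f : smooth_on U f <-> forall m, diffn U m f.
Proof.
split=> [sf m|h I x Ux].
  elim: m f sf => [|m IH] f sf; split=> //; try exact: (sf [::]).
  by move=> i; apply: IH => I; have := sf (rcons I i); rewrite iter_seq_rcons.
elim/last_ind: I f h => [|I i IH] f h; first exact: diffn_diff (h 0%N) Ux.
by rewrite iter_seq_rcons; apply: IH => m; have [_] := h m.+1; exact.
Qed.

Lemma diffn_eq_on U m f g : open U -> eq_on U f g -> diffn U m f -> diffn U m g.
Proof.
move=> oU; elim: m f g => [|m IH] f g fg [df h]; split=> //.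
- by move=> x Ux; apply: differentiable_eq_on fg (df x Ux).
- by move=> x Ux; apply: differentiable_eq_on fg (df x Ux).
- move=> i; apply: IH (h i); exact: partial_eq_on.
Qed.

Lemma partialD f g i x : differentiable f x -> differentiable g x ->
  partial i (fun y => f y + g y) x = partial i f x + partial i g x.
Proof.
by move=> df dg; rewrite /partial (@deriveD _ _ _ f g)//; exact: diff_derivable.
Qed.

Lemma partialM f g i x : differentiable f x -> differentiable g x ->
  partial i (fun y => f y * g y) x = partial i f x * g x + f x * partial i g x.
Proof.
move=> df dg; rewrite /partial (@deriveM _ _ f g); try exact: diff_derivable.
by rewrite addrC [g x *: _]mulrC.
Qed.

Lemma partial_cst (c : R) i x : partial i (fun _ : 'rV[R]_n => c) x = 0.
Proof. exact: derive_cst. Qed.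

Lemma partial_coord i k x : partial i (fun y : 'rV[R]_n => y 0 k) x = (i == k)%:R.
Proof.
have [did _] := is_diff_id x.
have E := derive_row (delta_mx 0 i) k did.
by rewrite /partial -[LHS]E derive_id mxE eqxx eq_sym.
Qed.

Lemma diffnD U m f g : open U -> diffn U m f -> diffn U m g ->
  diffn U m (fun x => f x + g x).
Proof.
move=> oU; elim: m f g => [|m IH] f g [df hf] [dg hg]; split=> //.
- by move=> x Ux; apply: (@differentiableD _ _ _ f g); [exact: df|exact: dg].
- by move=> x Ux; apply: (@differentiableD _ _ _ f g); [exact: df|exact: dg].
move=> i; apply: diffn_eq_on (IH _ _ (hf i) (hg i)) => // x Ux.
by rewrite partialD//; [exact: df|exact: dg].
Qed.

Lemma diffnM U m f g : open U -> diffn U m f -> diffn U m g ->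
  diffn U m (fun x => f x * g x).
Proof.
move=> oU; elim: m f g => [|m IH] f g [df hf] [dg hg]; split=> //.
- by move=> x Ux; apply: (@differentiableM _ _ f g); [exact: df|exact: dg].
- by move=> x Ux; apply: (@differentiableM _ _ f g); [exact: df|exact: dg].
move=> i; have dMm : diffn U m (fun x => partial i f x * g x + f x * partial i g x).
  apply: diffnD => //; first by apply: IH (hf i) _; exact: diffnS.
  by apply: IH _ (hg i); exact: diffnS.
apply: diffn_eq_on dMm => // x Ux.
by rewrite partialM//; [exact: df|exact: dg].
Qed.

Lemma smooth_diff U f x : smooth_on U f -> U x -> differentiable f x.
Proof. by move=> sf; exact: (sf [::]). Qed.

Lemma smooth_partial U f i : smooth_on U f -> smooth_on U (partial i f).
Proof. by move=> sf I; have := sf (rcons I i); rewrite iter_seq_rcons. Qed.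

Lemma smooth_iter U f I : smooth_on U f -> smooth_on U (iter_seq (@partial R n) I f).
Proof. by move=> sf J; have := sf (J ++ I); rewrite iter_seq_cat. Qed.

Lemma smooth_eq_on U f g : open U -> eq_on U f g -> smooth_on U f -> smooth_on U g.
Proof.
move=> oU fg /smooth_diffn sf; apply/smooth_diffn => m; exact: diffn_eq_on (sf m).
Qed.

Lemma smoothD U f g : open U -> smooth_on U f -> smooth_on U g ->
  smooth_on U (fun x => f x + g x).
Proof.
move=> oU /smooth_diffn sf /smooth_diffn sg.
by apply/smooth_diffn => m; exact: diffnD.
Qed.

Lemma smoothM U f g : open U -> smooth_on U f -> smooth_on U g ->
  smooth_on U (fun x => f x * g x).
Proof.
move=> oU /smooth_diffn sf /smooth_diffn sg.
by apply/smooth_diffn => m; exact: diffnM.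
Qed.

Lemma smooth_cst U (c : R) : smooth_on U (fun _ : 'rV[R]_n => c).
Proof.
apply/smooth_diffn => m; elim: m c => [|m IH] c; split=> //;
  try by move=> x _; exact: differentiable_cst.
move=> i; have -> : partial i (fun _ : 'rV[R]_n => c) = fun=> 0; last exact: IH.
by apply/funext => x; rewrite partial_cst.
Qed.

Lemma smooth_coord U k : smooth_on U (fun x : 'rV[R]_n => x 0 k).
Proof.
move=> I x _; elim/last_ind: I => [|I i _]; first exact: differentiable_coord.
rewrite iter_seq_rcons.
have -> : partial i (fun y : 'rV[R]_n => y 0 k) = fun=> (i == k)%:R.
  by apply/funext => y; rewrite partial_coord.
exact: (@smooth_cst setT).
Qed.

Lemma smooth_sum U (T : Type) (r : seq T) (P : pred T) (f : T -> F) : open U ->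
  (forall i, P i -> smooth_on U (f i)) ->
  smooth_on U (fun x => \sum_(i <- r | P i) f i x).
Proof.
move=> oU sf; elim: r => [|i r IH].
  by apply: (smooth_eq_on oU _ (smooth_cst 0)) => x _; rewrite big_nil.
case Pi: (P i).
  apply: (smooth_eq_on oU _ (smoothD oU (sf i Pi) IH)) => x _.
  by rewrite big_cons Pi.
by apply: (smooth_eq_on oU _ IH) => x _; rewrite big_cons Pi.
Qed.

Lemma partial_sum (T : Type) (r : seq T) (P : pred T) (f : T -> F) i x :
  (forall j, P j -> differentiable (f j) x) ->
  partial i (fun y => \sum_(j <- r | P j) f j y) x
  = \sum_(j <- r | P j) partial i (f j) x.
Proof.
move=> df; suff [] : differentiable (fun y => \sum_(j <- r | P j) f j y) x /\
  partial i (fun y => \sum_(j <- r | P j) f j y) x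
  = \sum_(j <- r | P j) partial i (f j) x by [].
elim: r => [|j r [IH1 IH2]].
  have -> : (fun y => \sum_(j <- [::] | P j) f j y) = fun=> 0.
    by apply/funext => y; rewrite big_nil.
  by rewrite big_nil partial_cst; split=> //; exact: differentiable_cst.
rewrite big_cons; case Pj: (P j); last first.
  have -> // : (fun y => \sum_(j <- j :: r | P j) f j y)
    = fun y => \sum_(j <- r | P j) f j y.
  by apply/funext => y; rewrite big_cons Pj.
have -> : (fun y => \sum_(j <- j :: r | P j) f j y)
    = fun y => f j y + \sum_(j <- r | P j) f j y.
  by apply/funext => y; rewrite big_cons Pj.
have dj := df _ Pj; rewrite (partialD _ dj IH1) IH2; split=> //.
exact: (differentiableD dj IH1).
Qed.

Lemma partial_partial U f i j x : open U -> smooth_on U f -> U x ->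
  partial i (partial j f) x = partial j (partial i f) x.
Proof.
move=> oU sf Ux.
have /nbhs_ballP[d /= d0 dU] : nbhs x U by exact: open_nbhs_nbhs.
apply: (@derive_swap _ _ f x _ _ d) => //; try exact: norm_delta_le1.
- by move=> y /dU; exact: smooth_diff.
- by move=> y /dU; exact/smooth_diff/smooth_partial.
- by move=> y /dU; exact/smooth_diff/smooth_partial.
- apply: differentiable_continuous.
  exact: (smooth_diff (smooth_partial i (smooth_partial j sf)) Ux).
- apply: differentiable_continuous.
  exact: (smooth_diff (smooth_partial j (smooth_partial i sf)) Ux).
Qed.

End Smooth.

(** * The chain rule and smoothness of composites *)

Section Composition.
Variables (R : realType) (m n : nat).

Lemma diffn_sum (U : set 'rV[R]_m) p (T : Type) (r : seq T)
    (f : T -> 'rV[R]_m -> R) : open U ->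
  (forall i, diffn U p (f i)) -> diffn U p (fun x => \sum_(i <- r) f i x).
Proof.
move=> oU df; elim: r => [|i r IH].
  have /smooth_diffn /(_ p) := @smooth_cst R m U 0.
  by apply: diffn_eq_on => // x _; rewrite big_nil.
by apply: diffn_eq_on (diffnD oU (df i) IH) => // x _; rewrite big_cons.
Qed.

Lemma partial_comp (psi : 'rV[R]_m -> 'rV[R]_n) (h : 'rV[R]_n -> R) i x :
  (forall k, differentiable (fun y => psi y 0 k) x) ->
  differentiable h (psi x) ->
  partial i (h \o psi) x
  = \sum_k partial i (fun y => psi y 0 k) x * partial k h (psi x).
Proof. exact: derive_comp_row. Qed.

(** Induction on the order, for all [h] at once: by the chain rule a partial derivative of
    [h \o psi] is a sum of products of smooth functions with composites [partial k h \o psi], which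
    have one order less to check. *)
Lemma smooth_comp (U : set 'rV[R]_m) (W : set 'rV[R]_n)
    (psi : 'rV[R]_m -> 'rV[R]_n) (h : 'rV[R]_n -> R) :
  open U -> smooth_map U psi -> (forall x, U x -> W (psi x)) ->
  smooth_on W h -> smooth_on U (h \o psi).
Proof.
move=> oU spsi UW /smooth_diffn sh; apply/smooth_diffn => p.
elim: p h {sh}(sh p) => [|p IH] h [dh hh].
  split=> // x Ux; apply: differentiable_comp; last exact/dh/UW.
  by apply: differentiable_row => k; exact: smooth_diff (spsi k) Ux.
have dk k x : U x -> differentiable (fun y => psi y 0 k) x.
  by move=> Ux; exact: smooth_diff (spsi k) Ux.
split=> [x Ux|i].
  apply: differentiable_comp; last exact/dh/UW.
  by apply: differentiable_row => k; exact: dk.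
pose g x := \sum_k partial i (fun y => psi y 0 k) x * (partial k h \o psi) x.
apply: (@diffn_eq_on _ _ _ _ g) => //.
  by move=> x Ux; rewrite partial_comp//; [move=> k; exact: dk|exact/dh/UW].
apply: diffn_sum => // k; apply: diffnM => //; last exact: IH (hh k).
by have /smooth_diffn /(_ p) := smooth_partial i (spsi k).
Qed.

End Composition.

(** * Orders of vanishing and weights *)

Section Order.
Variables (R : realType) (n : nat).
Local Notation F := ('rV[R]_n -> R).
Variables (U : set 'rV[R]_n) (oU : open U) (U0 : U 0).
Implicit Types (f g : F) (D : 'I_n -> F -> F).

(** What [partial i] and [vf_op Y] have in common, so that one theory of vanishing serves both
    weight and order. Functions are total and only their values on [U] count, hence the locality
    clause [der_eq_on]. *)
Record derivation_on (D : F -> F) : Prop := {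
  der_smooth : forall f, smooth_on U f -> smooth_on U (D f);
  der_eq_on : forall f g, eq_on U f g -> eq_on U (D f) (D g);
  derD : forall f g, smooth_on U f -> smooth_on U g ->
    eq_on U (D (fun x => f x + g x)) (fun x => D f x + D g x);
  derM : forall f g, smooth_on U f -> smooth_on U g ->
    eq_on U (D (fun x => f x * g x)) (fun x => D f x * g x + f x * D g x) }.

Lemma derivation_partial i : derivation_on (partial i).
Proof.
split=> [f|f g|f g sf sg x Ux|f g sf sg x Ux]; first exact: smooth_partial.
- exact: partial_eq_on.
- by rewrite partialD//; [exact: smooth_diff sf Ux|exact: smooth_diff sg Ux].
- by rewrite partialM//; [exact: smooth_diff sf Ux|exact: smooth_diff sg Ux].
Qed.

Lemma derivation_vf_op (Y : 'rV[R]_n -> 'rV[R]_n) :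
  smooth_map U Y -> derivation_on (vf_op Y).
Proof.
move=> sY; split=> [f sf|f g fg x Ux|f g sf sg x Ux|f g sf sg x Ux].
- apply: smooth_sum => // k _; apply: smoothM => //.
  exact: smooth_partial.
- by apply: eq_bigr => k _; rewrite (partial_eq_on k oU fg Ux).
- rewrite -big_split; apply: eq_bigr => k _ /=.
  by rewrite (derD (derivation_partial k) sf sg Ux) mulrDr.
- rewrite mulr_suml mulr_sumr -big_split; apply: eq_bigr => k _ /=.
  by rewrite (derM (derivation_partial k) sf sg Ux); ring.
Qed.

Section Iter.
Variables (D : 'I_n -> F -> F) (hD : forall i, derivation_on (D i)).

Lemma der_iter_smooth I f : smooth_on U f -> smooth_on U (iter_seq D I f).
Proof. by move=> sf; elim: I => //= i I; exact/der_smooth. Qed.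

Lemma der_iter_eq_on I f g : eq_on U f g ->
  eq_on U (iter_seq D I f) (iter_seq D I g).
Proof. by move=> fg; elim: I => //= i I; exact/der_eq_on. Qed.

Lemma der_iterD I f g : smooth_on U f -> smooth_on U g ->
  eq_on U (iter_seq D I (fun x => f x + g x))
    (fun x => iter_seq D I f x + iter_seq D I g x).
Proof.
move=> sf sg; elim: I => //= i I IH x Ux.
by rewrite (der_eq_on (hD i) IH Ux) (derD (hD i))//; exact: der_iter_smooth.
Qed.

End Iter.

(** [N] is a natural number: in bounds such as [N - w i], truncation turns a negative order into the
    trivial condition. *)
Definition ord_ge D (w : 'I_n -> nat) f (N : nat) : Prop :=
  forall I, (seq_weight w I < N)%N -> iter_seq D I f 0 = 0.

Lemma seq_weight_rcons (w : 'I_n -> nat) I i :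
  seq_weight w (rcons I i) = (seq_weight w I + w i)%N.
Proof. by rewrite /seq_weight -cats1 big_cat big_seq1. Qed.

Variable (w : 'I_n -> nat).
Variables (D : 'I_n -> F -> F) (hD : forall i, derivation_on (D i)).

Lemma ord_ge0 f : ord_ge D w f 0.
Proof. by []. Qed.

Lemma ord_leq f N N' : (N' <= N)%N -> ord_ge D w f N -> ord_ge D w f N'.
Proof. by move=> NN fN I h; apply: fN; exact: leq_trans NN. Qed.

Lemma ord_val f N : ord_ge D w f N -> (0 < N)%N -> f 0 = 0.
Proof. by move=> fN N0; apply: (fN [::]); rewrite /seq_weight big_nil. Qed.

Lemma ord_der i f N : ord_ge D w f N -> ord_ge D w (D i f) (N - w i).
Proof.
move=> fN I h; rewrite -iter_seq_rcons; apply: fN.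
by rewrite seq_weight_rcons; lia.
Qed.

Lemma ord_iter I f N : ord_ge D w f N ->
  ord_ge D w (iter_seq D I f) (N - seq_weight w I).
Proof.
move=> fN J h; rewrite -iter_seq_cat; apply: fN.
by move: h; rewrite /seq_weight big_cat/=; lia.
Qed.

Lemma ord_eq_on f g N : eq_on U f g -> ord_ge D w f N -> ord_ge D w g N.
Proof. by move=> fg fN I h; rewrite -(der_iter_eq_on hD I fg U0) fN. Qed.

Lemma ordD f g N : smooth_on U f -> smooth_on U g ->
  ord_ge D w f N -> ord_ge D w g N -> ord_ge D w (fun x => f x + g x) N.
Proof.
by move=> sf sg fN gN I h; rewrite (der_iterD hD I sf sg U0) fN// gN// addr0.
Qed.

(** Leibniz rule for the innermost derivation of the word: it lowers the order of one of the two
    factors by at most [w i], and the induction applies to both products. *)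
Lemma ordM f g N N' : smooth_on U f -> smooth_on U g ->
  ord_ge D w f N -> ord_ge D w g N' -> ord_ge D w (fun x => f x * g x) (N + N').
Proof.
move=> sf sg fN gN I.
elim/last_ind: I f g N N' sf sg fN gN => [|I i IH] f g N N' sf sg fN gN.
  rewrite /seq_weight big_nil /= addn_gt0 => /orP[N0|N0].
    by rewrite (ord_val fN N0) mul0r.
  by rewrite (ord_val gN N0) mulr0.
rewrite seq_weight_rcons iter_seq_rcons => h.
rewrite (der_iter_eq_on hD I (derM (hD i) sf sg) U0).
have sDf := der_smooth (hD i) sf; have sDg := der_smooth (hD i) sg.
rewrite der_iterD//; try exact: smoothM.
rewrite (IH (D i f) g (N - w i)%N N')//; [|exact: ord_der|lia].
by rewrite (IH f (D i g) N (N' - w i)%N)//; [rewrite addr0|exact: ord_der|lia].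
Qed.

Lemma ord_cst0 N : ord_ge D w (fun=> 0) N.
Proof.
(* A derivation kills 0 by the Leibniz rule for [0 * 0]. *)
have E : eq_on U (fun=> 0) (fun x => 0 * 0 : R) by move=> x _; rewrite mulr0.
move=> I _; elim/last_ind: I => [//|I i IH]; rewrite iter_seq_rcons.
rewrite -[RHS]IH; apply: der_iter_eq_on => // x Ux.
rewrite (der_eq_on (hD i) E Ux) (derM (hD i))//; try exact: smooth_cst.
by rewrite mulr0 mul0r addr0.
Qed.

Lemma ord_sum (T : Type) (r : seq T) (P : pred T) (f : T -> F) N :
  (forall i, P i -> smooth_on U (f i)) -> (forall i, P i -> ord_ge D w (f i) N) ->
  ord_ge D w (fun x => \sum_(i <- r | P i) f i x) N.
Proof.
move=> sf fN; elim: r => [|i r IH].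
  by apply: (ord_eq_on _ (@ord_cst0 N)) => x _; rewrite big_nil.
case Pi: (P i); last by apply: (ord_eq_on _ IH) => x _; rewrite big_cons Pi.
apply: (@ord_eq_on (fun x => f i x + \sum_(i <- r | P i) f i x)).
  by move=> x _; rewrite big_cons Pi.
apply: ordD => //; [exact: sf|exact: smooth_sum|exact: fN].
Qed.

Lemma ordP f N : ((0 < N)%N -> f 0 = 0) ->
  (forall i, ord_ge D w (D i f) (N - w i)) -> ord_ge D w f N.
Proof.
move=> f0 Df I; case/lastP: I => [|I i].
  by rewrite /seq_weight big_nil => /f0.
by rewrite seq_weight_rcons iter_seq_rcons => h; apply: Df; lia.
Qed.

End Order.

(** * Multi-orders and words *)

Section Multi.
Variable n : nat.
Implicit Types (al : multi n) (I J : seq 'I_n).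

(** Turns [\partial^al] and [X^al] into iterations along a word; [mult] goes back, and identifies
    words up to permutation. *)
Definition word al : seq 'I_n := flatten [seq nseq (al i) i | i <- enum 'I_n].

Definition mult I : multi n := [ffun i => count_mem i I].

Lemma iter_multi_word (F : Type) (D : 'I_n -> F -> F) al f :
  iter_multi D al f = iter_seq D (word al) f.
Proof.
rewrite /iter_multi /word; elim: (enum _) => //= i s ->.
rewrite /iter_seq foldr_cat; elim: (al i) => //= k IH.
by rewrite -IH.
Qed.

Lemma sum_word (h : 'I_n -> nat) al :
  (\sum_(i <- word al) h i = \sum_i h i * al i)%N.
Proof.
rewrite /word big_flatten big_map big_enum; apply: eq_bigr => i _.
by rewrite big_nseq iter_addn_0.
Qed.

Lemma seq_weight_word w al : seq_weight w (word al) = multi_weight w al.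
Proof. exact: sum_word. Qed.

Lemma size_word al : size (word al) = mlen al.
Proof.
by rewrite -sum1_size sum_word; apply: eq_bigr => i _; rewrite mul1n.
Qed.

Lemma count_word i al : count_mem i (word al) = al i.
Proof.
rewrite -sum1_count big_mkcond/= sum_word (bigD1 i)//= eqxx mul1n.
by rewrite big1 ?addn0// => j /negbTE ->.
Qed.

Lemma mult_word al : mult (word al) = al.
Proof. by apply/ffunP => i; rewrite ffunE count_word. Qed.

Lemma perm_mult I J : (mult I == mult J) = perm_eq I J.
Proof.
apply/eqP/idP => [/ffunP E|/permP E].
  by apply/allP => i _ /=; have := E i; rewrite !ffunE => ->.
by apply/ffunP => i; rewrite !ffunE E.
Qed.

Lemma perm_word I : perm_eq (word (mult I)) I.
Proof. by rewrite -perm_mult mult_word. Qed.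

Lemma perm_weight w I J : perm_eq I J -> seq_weight w I = seq_weight w J.
Proof. by move=> IJ; apply: perm_big. Qed.

End Multi.

(** * Weight as order of vanishing for the partial derivatives *)

Section Weight.
Variables (R : realType) (n : nat) (w : 'I_n -> nat).
Local Notation F := ('rV[R]_n -> R).
Variables (U : set 'rV[R]_n) (oU : open U).
Implicit Types (f g : F).
Local Notation dI := (iter_seq (@partial R n)).

Lemma iter_partialC I i f : smooth_on U f ->
  eq_on U (dI I (partial i f)) (partial i (dI I f)).
Proof.
move=> sf; elim: I => //= j I IH x Ux.
rewrite (partial_eq_on j oU IH Ux).
by rewrite (partial_partial j i oU (smooth_iter I sf) Ux).
Qed.

Lemma iter_partial_perm I J f : smooth_on U f -> perm_eq I J ->
  eq_on U (dI I f) (dI J f).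
Proof.
move=> sf; elim: I J => [|i I IH] J; first by rewrite perm_sym => /perm_nilP ->.
move=> IJ; have iJ : i \in J by rewrite -(perm_mem IJ) mem_head.
move: IJ; case/splitPr: iJ => J1 J2.
rewrite perm_sym -cat1s perm_catCA perm_cons perm_sym => IJ x Ux /=.
rewrite (partial_eq_on i oU (IH _ IJ) Ux) !iter_seq_cat /=.
by rewrite (iter_partialC J1 i (smooth_iter J2 sf) Ux).
Qed.

Hypothesis U0 : U 0.

(** The weight tests only the sorted words and the order tests all of them; partial derivatives
    commute on [U], so the two agree. When [b < a] both conditions are empty. *)
Lemma weight_geP f (a b : nat) : smooth_on U f ->
  weight_ge w f (- a%:Z + b%:Z) <-> ord_ge (@partial R n) w f (b - a).
Proof.
move=> sf; have E (m : nat) : (m%:Z < - a%:Z + b%:Z) = (m < b - a)%N by lia.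
split=> [h I|h al]; last first.
  by rewrite E -seq_weight_word iter_multi_word; exact: h.
rewrite -(perm_weight w (perm_word I)) seq_weight_word -E => /h.
by rewrite iter_multi_word (iter_partial_perm sf (perm_word I) U0).
Qed.

Lemma has_weight0 f : f 0 != 0 -> has_weight w f 0.
Proof.
move=> f0; split=> [al|]; first by rewrite ltNge.
exists [ffun=> 0%N]; first by rewrite /multi_weight big1// => i; rewrite ffunE muln0.
rewrite iter_multi_word; suff -> : word [ffun=> 0%N] = [::] :> seq 'I_n by [].
by apply/eqP; rewrite -size_eq0 size_word /mlen big1// => i; rewrite ffunE.
Qed.

End Weight.

(** * Frame monomials as differential operators *)

Section Operators.
Variables (R : realType) (n : nat) (w : 'I_n -> nat).
Local Notation F := ('rV[R]_n -> R).
Variables (U : set 'rV[R]_n) (oU : open U) (U0 : U 0).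
Implicit Types (f g : F).
Local Notation dI := (iter_seq (@partial R n)).
Local Notation ord := (ord_ge (@partial R n) w).
Local Notation hdP := (fun i => derivation_partial oU i).
Variable Y : 'I_n -> 'rV[R]_n -> 'rV[R]_n.
Hypothesis sY : forall j, smooth_map U (Y j).
Hypothesis Y0 : forall j, Y j 0 = delta_mx 0 j.
Local Notation YI := (iter_seq (fun j => vf_op (Y j))).

Local Notation hdY := (fun j => derivation_vf_op oU (sY j)).

(* The terms [p.1 * \partial_(p.2)] of [Y_I - \partial_I]: those of the top
   order [size I] have coefficients vanishing at 0. *)
Definition remainder_term (I : seq 'I_n) (p : F * seq 'I_n) : Prop :=
  [/\ smooth_on U p.1, ord p.1 (seq_weight w p.2 - seq_weight w I),
      (size p.2 <= size I)%N & size p.2 = size I -> p.1 0 = 0].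

Hypothesis Yord : forall j k, ord (fun x => Y j x 0 k) (w k - w j).

Lemma seq_weight_cons i I : seq_weight w (i :: I) = (w i + seq_weight w I)%N.
Proof. by rewrite /seq_weight big_cons. Qed.

(** Each term [Y_jk * \partial_k f] has order at least [(w k - w j) + (N - w k)], and this is at
    least [N - w j] even with truncated differences. *)
Lemma vf_op_ord j f N : smooth_on U f -> ord f N -> ord (vf_op (Y j) f) (N - w j).
Proof.
move=> sf fN; apply: (ord_sum oU U0 hdP) => k _.
  by apply: (smoothM oU (sY j k)); exact: smooth_partial.
have H := ordM oU U0 hdP (sY j k) (smooth_partial k sf) (@Yord j k) (ord_der (i:=k) fN).
apply: (ord_leq _ H).
by lia.
Qed.

Lemma vf_op_sum (T : eqType) (r : seq T) (f : T -> F) (Z : 'rV[R]_n -> 'rV[R]_n) x :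
  (forall p, p \in r -> differentiable (f p) x) ->
  vf_op Z (fun y => \sum_(p <- r) f p y) x = \sum_(p <- r) vf_op Z (f p) x.
Proof.
move=> df; rewrite /vf_op exchange_big/=; apply: eq_bigr => k _.
have -> : (fun y => \sum_(p <- r) f p y) = fun y => \sum_(p <- r | p \in r) f p y.
  by apply/funext => y; rewrite -big_seq.
by rewrite partial_sum// -big_seq mulr_sumr.
Qed.

Lemma monomial_expansion I : exists s : seq (F * seq 'I_n),
  (forall p, p \in s -> remainder_term I p) /\
  forall u, smooth_on U u ->
    eq_on U (YI I u) (fun x => dI I u x + \sum_(p <- s) p.1 x * dI p.2 u x).
Proof.
elim: I => [|j I [s [hs sE]]].
  by exists [::]; split=> // u su x Ux; rewrite big_nil addr0.
(* The remainder after applying [Y_j] to the expansion for [I]: [s1] is [Y_j - \partial_j] on the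
   leading term, [s2] has [Y_j] acting on a coefficient, and [s3] has it acting on the derivative of
   [u]. *)
pose s1 := [seq ((fun x => Y j x 0 k - (k == j)%:R) : F, k :: I) | k <- enum 'I_n].
pose s2 := [seq (vf_op (Y j) p.1, p.2) | p <- s].
pose s3 := [seq ((fun x => Y j x 0 k * p.1 x) : F, k :: p.2) | p <- s, k <- enum 'I_n].
exists (s1 ++ s2 ++ s3); split.
  move=> p; rewrite !mem_cat.
  case/or3P=> [/mapP[k _ ->]|/mapP[q qs ->]|/allpairsP[[q k] [/= qs _ ->]]].
  - split=> //=.
    + by apply: (smoothD oU (sY j k)); exact: smooth_cst.
    + rewrite !seq_weight_cons subnDr.
      apply: (ordD U0 hdP (sY j k) (smooth_cst (- (k == j)%:R)) (@Yord j k)).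
      have [->|_] := eqVneq k j; first by rewrite subnn.
      by rewrite oppr0; exact: (ord_cst0 U0 hdP).
    + by move=> _; rewrite Y0 mxE eqxx subrr.
  - have [sq oq szq q0] := hs _ qs; split=> /=.
    + exact: (der_smooth (hdY j)).
    + rewrite seq_weight_cons; apply: ord_leq (vf_op_ord (j:=j) sq oq).
      lia.
    + exact: leqW.
    (* The word has not grown, so it is shorter than [j :: I]. *)
    + by move=> E; move: szq; rewrite E ltnn.
  - have [sq oq szq q0] := hs _ qs; split=> //=.
    + exact: (smoothM oU (sY j k) sq).
    + rewrite !seq_weight_cons.
      by apply: (ord_leq _ (ordM oU U0 hdP (sY j k) sq (@Yord j k) oq)); lia.
    + by move=> [/q0 ->]; rewrite mulr0.
move=> u su x Ux /=; rewrite (der_eq_on (hdY j) (sE u su) Ux).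
have sq p : p \in s -> smooth_on U (fun x => p.1 x * dI p.2 u x).
  by move=> /hs[sp _ _ _]; apply: smoothM => //; exact: smooth_iter.

rewrite (derD (hdY j) _ _ Ux); [|exact: smooth_iter|]; last first.
  have sS : smooth_on U (fun x => \sum_(p <- s | p \in s) p.1 x * dI p.2 u x).
    exact: smooth_sum.
  by apply: smooth_eq_on sS => // y _; rewrite -big_seq.
rewrite vf_op_sum => [|p ps]; last exact: smooth_diff (sq p ps) Ux.
have E1 : \sum_(p <- s1) p.1 x * dI p.2 u x
    = \sum_k (Y j x 0 k - (k == j)%:R) * partial k (dI I u) x.
  by rewrite /s1 big_map big_enum.
have E3 : \sum_(p <- s3) p.1 x * dI p.2 u x
    = \sum_(p <- s) \sum_k Y j x 0 k * p.1 x * partial k (dI p.2 u) x.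
  by rewrite /s3 big_allpairs_dep; apply: eq_bigr => p _; rewrite big_enum.
rewrite !big_cat E1 E3 /s2 big_map/=.
rewrite [RHS]addrA; congr (_ + _).
  rewrite [X in _ = _ + X](_ : _ = vf_op (Y j) (dI I u) x - partial j (dI I u) x).
    by rewrite addrC subrK.
  rewrite /vf_op (bigD1 j)//= [in RHS](bigD1 j)//= eqxx mulrBl mul1r.
  rewrite [in RHS]addrAC; congr (_ + _).
  by apply: eq_bigr => k /negbTE ->; rewrite subr0.
rewrite -big_split big_seq [RHS]big_seq; apply: eq_bigr => p /= /hs[sp _ _ _].
rewrite (derM (hdY j) sp (smooth_iter _ su) Ux); congr (_ + _).
rewrite /vf_op mulr_sumr; apply: eq_bigr => k _; ring.
Qed.

(** Terms whose words have the same letter counts are collected into one coefficient. That of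
    [mult I] equals 1 at 0, since the other words counted there are as long as [I] and their
    coefficients vanish at 0; hence the weight is attained. *)
Lemma expansion_diffop (P : operator R n) I (s : seq (F * seq 'I_n)) :
  (forall p, p \in s -> remainder_term I p) ->
  (forall u, smooth_on U u ->
    eq_on U (P u) (fun x => dI I u x + \sum_(p <- s) p.1 x * dI p.2 u x)) ->
  diffop_weight w U P (- (seq_weight w I)%:Z).
Proof.
move=> hs sP; pose L : seq (F * seq 'I_n) := ((fun=> 1), I) :: s.
have hL p : p \in L -> [/\ smooth_on U p.1,
    ord p.1 (seq_weight w p.2 - seq_weight w I) & (size p.2 <= size I)%N].
  rewrite inE => /predU1P[-> /=|/hs[]//]; split=> //; first exact: smooth_cst.
  by rewrite subnn.
pose a (al : multi n) x := \sum_(p <- L | mult p.2 == al) p.1 x.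
have aE al : a al = fun x => \sum_(p <- L | (p \in L) && (mult p.2 == al)) p.1 x.
  by apply/funext => x; rewrite /a -big_seq_cond.
have sa al : smooth_on U (a al).
  by rewrite aE; apply: smooth_sum => // p /andP[/hL[]].
exists (size I), a; split.
- split=> // u su x Ux; rewrite (sP u su x Ux).
  have -> : dI I u x + \sum_(p <- s) p.1 x * dI p.2 u x
      = \sum_(p <- L) p.1 x * dI p.2 u x by rewrite big_cons/= mul1r.
  transitivity (\sum_(be : {ffun 'I_n -> 'I_(size I).+1} | (\sum_i be i <= size I)%N)
    \sum_(p <- L | mult p.2 == [ffun i => nat_of_ord (be i)]) p.1 x * dI p.2 u x);
    last first.
    apply: eq_bigr => be _ /=; rewrite /a mulr_suml; apply: eq_bigr => p /eqP <-.
    by rewrite iter_multi_word (iter_partial_perm oU su (perm_word _) Ux).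
  rewrite (exchange_big_dep xpredT)//= big_seq [RHS]big_seq.
  apply: eq_bigr => p /hL[_ _ szp].
  (* Each word contributes to exactly one exponent of the finite sum, its letter counts, which are
     bounded by [size I]. *)
  have cI i : (count_mem i p.2 < (size I).+1)%N.
    by rewrite ltnS (leq_trans (count_size _ _)).
  rewrite (big_pred1 [ffun i => Ordinal (cI i)])// => be /=.
  apply/andP/eqP => [[_ /eqP/ffunP E]|->].
    by apply/ffunP => i; apply/val_inj; have := E i; rewrite !ffunE.
  have E : mult p.2 = [ffun i => nat_of_ord ([ffun i => Ordinal (cI i)] i)].
    by apply/ffunP => i; rewrite !ffunE.
  split; last exact/eqP.
  have := size_word (mult p.2); rewrite (perm_size (perm_word _)) => szE.
  apply: leq_trans szp; rewrite szE /mlen; apply: leq_sum => i _.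
  by rewrite !ffunE.
- move=> al _; apply/(weight_geP w oU U0 _ _ (sa al)); rewrite aE.
  apply: (ord_sum oU U0 hdP) => [p /andP[/hL[]]//|p /andP[/hL[_ op _] /eqP <-]].
  by rewrite -seq_weight_word (perm_weight w (perm_word _)).
- exists (mult I); first by rewrite -size_word (perm_size (perm_word I)).
  rewrite -seq_weight_word (perm_weight w (perm_word I)) addNr.
  apply: has_weight0; rewrite /a big_cons eqxx big_seq_cond big1 ?addr0 ?oner_neq0//.
  move=> p /andP[/hs[_ _ _ h]]; rewrite perm_mult => /perm_size; exact: h.
Qed.

Lemma monomial_weight I : diffop_weight w U (YI I) (- (seq_weight w I)%:Z).
Proof. by have [s [hs sE]] := monomial_expansion I; exact: expansion_diffop hs sE. Qed.

Lemma vf_op_coord (Z : 'rV[R]_n -> 'rV[R]_n) k :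
  vf_op Z (fun x => x 0 k) = fun x => Z x 0 k.
Proof.
apply/funext => x; rewrite /vf_op (bigD1 k)//= partial_coord eqxx mulr1.
by rewrite big1 ?addr0// => i /negbTE ik; rewrite partial_coord ik mulr0.
Qed.

Lemma ord_coord k : ord (fun x => x 0 k) (w k).
Proof.
apply: ordP => [_|i]; first by rewrite mxE.
have -> : partial i (fun x : 'rV[R]_n => x 0 k) = fun=> (i == k)%:R.
  by apply/funext => x; rewrite partial_coord.
by have [->|_] := eqVneq i k; [rewrite subnn|exact: (ord_cst0 U0 hdP)].
Qed.

End Operators.

(** * Coefficients of the frame: from weights, and from orders along the frame *)

Section Equivalences.
Variables (R : realType) (n : nat) (w : 'I_n -> nat).
Hypothesis w_gt0 : forall i, (0 < w i)%N.
Local Notation F := ('rV[R]_n -> R).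
Variables (U : set 'rV[R]_n) (oU : open U) (U0 : U 0).
Local Notation dI := (iter_seq (@partial R n)).
Local Notation ord := (ord_ge (@partial R n) w).
Local Notation hdP := (fun i => derivation_partial oU i).
Variable Y : 'I_n -> 'rV[R]_n -> 'rV[R]_n.
Hypothesis sY : forall j, smooth_map U (Y j).
Hypothesis Y0 : forall j, Y j 0 = delta_mx 0 j.
Local Notation YI := (iter_seq (fun j => vf_op (Y j))).
Local Notation ordY := (ord_ge (fun j => vf_op (Y j)) w).
Local Notation hdY := (fun j => derivation_vf_op oU (sY j)).

(** In each term [a_al * \partial^al u] the orders [<al> - v] and [N - <al>] add up to at least
    [N - v]. *)
Lemma diffop_ord (P : operator R n) v u N : diffop_weight w U P (- v%:Z) ->
  smooth_on U u -> ord u N -> ord (P u) (N - v).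
Proof.
move=> [m [a [[sa PE] wa _]]] su uN.
apply: (ord_eq_on U0 hdP (fun x Ux => esym (PE u su x Ux))) => /=.
apply: (ord_sum oU U0 hdP) => be hbe.
  apply: (smoothM oU (sa _)); rewrite iter_multi_word; exact: smooth_iter.
set al : multi n := finfun _; have al_m : (mlen al <= m)%N.
  by rewrite /mlen (eq_bigr (fun i => nat_of_ord (be i)))// => i _; rewrite ffunE.
have oa : ord (a al) (multi_weight w al - v).
  by apply/(weight_geP w oU U0 _ _ (sa al)); exact: wa.
have oi := ord_iter (I := word al) uN; rewrite seq_weight_word in oi.
rewrite iter_multi_word.
by apply: (ord_leq _ (ordM oU U0 hdP (sa al) (smooth_iter _ su) oa oi)); lia.
Qed.

Lemma coeff_ord_of_weight :
  (forall j, diffop_weight w U (vf_op (Y j)) (- (w j)%:Z)) ->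
  forall j k, ord (fun x => Y j x 0 k) (w k - w j).
Proof.
move=> wY j k; have ok := @ord_coord _ _ w _ oU U0 k.
have := diffop_ord (wY j) (smooth_coord k) ok.
by rewrite vf_op_coord.
Qed.

Lemma coord_order_of_ord : (forall j k, ord (fun x => Y j x 0 k) (w k - w j)) ->
  forall k, ordY (fun x => x 0 k) (w k).
Proof.
move=> oY k I h; apply: (@ord_val _ _ w (@partial R n) _ (w k - seq_weight w I)).
  elim: I {h} => [|i I IH].
    by rewrite /seq_weight big_nil subn0; exact: (ord_coord oU U0).
  rewrite seq_weight_cons addnC subnDA /=; apply: (vf_op_ord oU U0 sY oY _ IH).
  exact: (der_iter_smooth hdY I (smooth_coord k)).
by rewrite subn_gt0.
Qed.

Lemma ord_partial_of_frame f N k :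
  (forall k, ordY (fun x => x 0 k) (w k)) ->
  smooth_on U f -> ordY f N -> ordY (partial k f) (N - w k).
Proof.
move=> oX sf fN; pose c j l : F := fun x => Y j x 0 l - (l == j)%:R.
have sc j l : smooth_on U (c j l).
  by apply: (smoothD oU (sY j l)); exact: smooth_cst.
have cord j l : ordY (c j l) (maxn 1 (w l - w j)).
  have oY : ordY (fun x => Y j x 0 l) (w l - w j).
    by have := ord_der (i := j) (oX l); rewrite vf_op_coord.
  case: (ltnP 0 (w l - w j)) => wlj.
    have -> : c j l = fun x => Y j x 0 l.
      apply/funext => x; rewrite /c; have [lj|_] := eqVneq l j; last by rewrite subr0.
      by rewrite lj subnn in wlj.
    by move/maxn_idPr: wlj => ->.
  (* As [w i >= 1], vanishing at 0 already means order at least 1. *)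
  apply: (@ord_leq _ _ _ _ _ 1); first by lia.
  apply: ordP => [_|i]; first by rewrite /c Y0 mxE eqxx subrr.
  by have -> : (1 - w i = 0)%N by have := w_gt0 i; lia.
(* The bound is gained one unit at a time: since [c j l] has order at least [maxn 1 (w l - w j)],
   the products with [\partial_l f] pass from [minn m (N - w l)] to at least
   [minn m.+1 (N - w j)]. *)
suff H m : forall j, ordY (partial j f) (minn m (N - w j)).
  by have := H N k; rewrite (minn_idPr (leq_subr _ _)).
elim: m => [|m IH] j; first by rewrite min0n.
have E : eq_on U (fun x => vf_op (Y j) f x + \sum_l (- 1 * c j l x) * partial l f x)
    (partial j f).
  move=> x Ux; rewrite /vf_op -big_split /= (bigD1 j)//= big1 /c.
    by rewrite eqxx mulr1n; ring.
  by move=> l /negbTE ->; rewrite mulr0n; ring.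
apply: (ord_eq_on U0 hdY E).
have sN l : smooth_on U (fun x => - 1 * c j l x).
  by apply: smoothM => //; exact: smooth_cst.
have sT l : smooth_on U (fun x => - 1 * c j l x * partial l f x).
  by apply: (smoothM oU (sN l)); exact: smooth_partial.
apply: (ordD U0 hdY (der_smooth (hdY j) sf)); first exact: smooth_sum.
  by apply: (ord_leq _ (ord_der (i := j) fN)); exact: geq_minr.
apply: (ord_sum oU U0 hdY) => // l _.
have oN : ordY (fun x => - 1 * c j l x) (0 + maxn 1 (w l - w j)).
  exact: (ordM oU U0 hdY (smooth_cst (-1)) (sc j l) (@ord_ge0 _ _ _ _ _) (cord j l)).
apply: (ord_leq _ (ordM oU U0 hdY (sN l) (smooth_partial l sf) oN (IH l))).
by lia.
Qed.

(** By [ord_partial_of_frame], [\partial_I f] keeps order at least [N - <I>] along the frame; when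
    this is positive, it vanishes at 0. *)
Lemma ord_of_frame f N : (forall k, ordY (fun x => x 0 k) (w k)) ->
  smooth_on U f -> ordY f N -> ord f N.
Proof.
move=> oX sf fN I h.
apply: (@ord_val _ _ w (fun j => vf_op (Y j)) _ (N - seq_weight w I)).
  elim: I {h} => [|i I IH]; first by rewrite /seq_weight big_nil subn0.
  rewrite seq_weight_cons addnC subnDA /=; apply: ord_partial_of_frame => //.
  exact: smooth_iter.
by rewrite subn_gt0.
Qed.

Lemma coeff_ord_of_order : (forall k, ordY (fun x => x 0 k) (w k)) ->
  forall j k, ord (fun x => Y j x 0 k) (w k - w j).
Proof.
move=> oX j k; apply: ord_of_frame => //; first exact: (sY j k).
by have := ord_der (i := j) (oX k); rewrite vf_op_coord.
Qed.

End Equivalences.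

(** * Dilations and weighted homogeneous parts *)

Section Dilation.
Variables (R : realType) (n : nat) (w : 'I_n -> nat).
Local Notation F := ('rV[R]_n -> R).
Local Notation dI := (iter_seq (@partial R n)).

Lemma iter_partialZ (V : set 'rV[R]_n) I (c : R) (f : F) : open V ->
  smooth_on V f -> eq_on V (dI I (fun x => c * f x)) (fun x => c * dI I f x).
Proof.
move=> oV sf; elim: I => //= i I IH x Vx.
rewrite (partial_eq_on i oV IH Vx).
rewrite (partialM i (differentiable_cst c x) (smooth_diff (smooth_iter I sf) Vx)).
by rewrite partial_cst mul0r add0r.
Qed.

Lemma smooth_dil (V : set 'rV[R]_n) t : open V -> smooth_map V (dil w t).
Proof.
move=> oV k; have sk := smoothM oV (smooth_cst (t ^+ w k)) (smooth_coord k).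
apply: (smooth_eq_on oV _ sk).
by move=> x _; rewrite mxE.
Qed.

Lemma partial_dil t i k (x : 'rV[R]_n) :
  partial i (fun y => dil w t y 0 k) x = t ^+ w k * (i == k)%:R.
Proof.
have -> : (fun y => dil w t y 0 k) = fun y => t ^+ w k * y 0 k.
  by apply/funext => y; rewrite mxE.
have := partialM i (differentiable_cst (t ^+ w k) x) (differentiable_coord x 0 k).
by rewrite partial_cst mul0r add0r partial_coord.
Qed.

Lemma partial_comp_dil t i (f : F) x : differentiable f (dil w t x) ->
  partial i (f \o dil w t) x = t ^+ w i * partial i f (dil w t x).
Proof.
move=> df; rewrite partial_comp//; last first.
  by move=> k; apply: (smooth_diff (smooth_dil t openT k)).
rewrite (bigD1 i)//= partial_dil eqxx mulr1 big1 ?addr0// => k ki.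
by rewrite partial_dil eq_sym (negbTE ki) mulr0 mul0r.
Qed.

Lemma norm_dil t (x : 'rV[R]_n) B : `|t| <= 1 -> (forall i, (0 < w i)%N) -> `|x| <= B ->
  `|dil w t x| <= `|t| * B.
Proof.
move=> t1 w0 xB; apply: norm_row_le => [|k].
  by rewrite mulr_ge0// (le_trans _ xB).
rewrite mxE normrM normrX; apply: ler_pM => //.
  by rewrite -[leRHS]expr1 ler_wiXn2l.
exact: le_trans (norm_coord_le _ _) xB.
Qed.

Lemma dilK t (x : 'rV[R]_n) : t != 0 -> dil w t^-1 (dil w t x) = x.
Proof.
move=> t0; apply/rowP => k; rewrite !mxE mulrA -exprMn mulVf//.
by rewrite expr1n mul1r.
Qed.

Lemma dil0 t : dil w t 0 = 0 :> 'rV[R]_n.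
Proof. by apply/rowP => k; rewrite !mxE mulr0. Qed.

Variables (U : set 'rV[R]_n) (oU : open U).

Lemma open_dil t : open (dil w t @^-1` U).
Proof.
apply: open_comp => // x _; apply: differentiable_continuous.
by apply: differentiable_row => k; exact: (smooth_diff (smooth_dil t openT k)).
Qed.

Lemma smooth_comp_dil t (f : F) : smooth_on U f ->
  smooth_on (dil w t @^-1` U) (f \o dil w t).
Proof.
by move=> sf; apply: smooth_comp sf => //; [exact: open_dil|exact/smooth_dil/open_dil].
Qed.

Lemma iter_comp_dil t I (f : F) : smooth_on U f ->
  eq_on (dil w t @^-1` U) (dI I (f \o dil w t))
    (fun x => t ^+ seq_weight w I * dI I f (dil w t x)).
Proof.
move=> sf; elim: I => [|i I IH] x Ux /=.
  by rewrite /seq_weight big_nil mul1r.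
rewrite (partial_eq_on i (open_dil (t := t)) IH Ux).
have sg := smooth_comp_dil (t := t) (smooth_iter I sf).
have := iter_partialZ [:: i] (t ^+ seq_weight w I) (open_dil (t := t)) sg Ux => /= ->.
rewrite partial_comp_dil; last exact: (smooth_diff (smooth_iter I sf) Ux).
by rewrite seq_weight_cons mulrA -exprD addnC.
Qed.

(** For [a = w j], [b = w k] and [f = Y_jk], the function differentiated is the k-th coefficient of
    [t^(w_j) \delta_t^* Y_j] minus a candidate limit [g]. *)
Lemma iter_rescaled t a b I (f g : F) : smooth_on U f -> smooth_on setT g ->
  eq_on (dil w t @^-1` U)
    (dI I (fun y => t ^+ a * (f (dil w t y) * t^-1 ^+ b) - g y))
    (fun x => t ^+ (a + seq_weight w I) / t ^+ b * dI I f (dil w t x) - dI I g x).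
Proof.
move=> sf sg x Ux; have oV := open_dil (t := t).
have sgV : smooth_on (dil w t @^-1` U) g by move=> J y _; exact: sg.
have sfV := smooth_comp_dil (t := t) sf.
pose c := t ^+ a * t^-1 ^+ b.
have -> : (fun y => t ^+ a * (f (dil w t y) * t^-1 ^+ b) - g y)
    = (fun y => c * (f \o dil w t) y + (-1) * g y).
  by apply/funext => y; rewrite /c /=; ring.
have hdP i := derivation_partial oV i.
have scf := smoothM oV (smooth_cst c) sfV.
have sNg := smoothM oV (smooth_cst (-1)) sgV.
rewrite (der_iterD hdP I scf sNg Ux).
rewrite (iter_partialZ I c oV sfV Ux) (iter_partialZ I (-1) oV sgV Ux).
by rewrite (iter_comp_dil I sf Ux) /c exprD exprVn; ring.
Qed.

Lemma pull_vfE t (Z : 'rV[R]_n -> 'rV[R]_n) x k :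
  pull_vf w t Z x 0 k = Z (dil w t x) 0 k * t^-1 ^+ w k.
Proof.
rewrite mxE /pull_op /vf_op (bigD1 k)//= big1 => [|i /negbTE ik].
  by rewrite partial_dil eqxx mulr1 addr0.
by rewrite partial_dil ik !mulr0.
Qed.

End Dilation.

(** To allow [t] of either sign, the segment starts at 0 with direction [t] and parameter in
    [0, 1]. *)
Lemma mvt_from0 (R : realType) (phi dphi : R -> R) (t : R) :
  (forall s : R, `|s| <= `|t| -> is_derive s (1 : R) phi (dphi s)) ->
  exists2 s, `|s| <= `|t| & phi t - phi 0 = t * dphi s.
Proof.
move=> dp; have df s : `|s| <= `|t| -> differentiable phi s.
  by move=> /dp[? _]; exact/derivable1_diffP.
have st s : 0 <= s <= 1 -> `|0 + s *: t| <= `|t|.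
  move=> /andP[s0 s1]; rewrite add0r normrZ (ger0_norm s0).
  by rewrite ler_piMl.
have [s s01] := @mvt_line R R phi 0 t 1 ler01 (fun s s01 => df _ (st s s01)).
rewrite add0r scale1r mul1r => E; exists (0 + s *: t); first exact: st.
have [ds dsE] := dp _ (st s s01).
rewrite E (deriveE _ (df _ (st s s01))) -dsE (deriveE _ (df _ (st s s01))).
by rewrite -[X in 'd _ _ X = _](mulr1 t) linearZ.
Qed.

(** * Weighted homogeneous parts of the Taylor expansion at 0 *)

Section HomogeneousPart.
Variables (R : realType) (n : nat) (w : 'I_n -> nat).
Hypothesis w_gt0 : forall i, (0 < w i)%N.
Local Notation F := ('rV[R]_n -> R).
Local Notation dI := (iter_seq (@partial R n)).

(* Euler's identity [N * f_N = \sum_i w_i x_i * (f_N)_i], where the partial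
   derivative [(f_N)_i] is the part of weight [N - w_i] of that of [f]; [m] is
   fuel, and any [m >= N] gives the same function. *)
Fixpoint hpart_rec (m N : nat) (f : F) : F :=
  if N is 0 then fun=> f 0
  else if m is m'.+1 then fun x => N%:R^-1 *
    \sum_(i | (w i <= N)%N) (w i)%:R * x 0 i * hpart_rec m' (N - w i) (partial i f) x
  else fun=> 0.

Definition hpart N (f : F) : F := hpart_rec N N f.

Lemma hpart_recS m N f x : hpart_rec m.+1 N.+1 f x = N.+1%:R^-1 *
  \sum_(i | (w i <= N.+1)%N)
    (w i)%:R * x 0 i * hpart_rec m (N.+1 - w i) (partial i f) x.
Proof. by []. Qed.

Lemma hpart_rec_fuel m m' N f : (N <= m)%N -> (N <= m')%N ->
  hpart_rec m N f = hpart_rec m' N f.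
Proof.
elim: m m' N f => [|m IH] [|m'] [|N] f //= Nm Nm'.
apply/funext => x; congr (_ * _); apply: eq_bigr => i _; congr (_ * _).
by rewrite (IH m')//; have := w_gt0 i; lia.
Qed.

Lemma hpart0 f : hpart 0 f = fun=> f 0.
Proof. by []. Qed.

Lemma hpart_pos N f : (0 < N)%N -> hpart N f = fun x => N%:R^-1 *
  \sum_(i | (w i <= N)%N) (w i)%:R * x 0 i * hpart (N - w i) (partial i f) x.
Proof.
case: N => // N _; apply/funext => x; rewrite /hpart hpart_recS; congr (_ * _).
apply: eq_bigr => i _; congr (_ * _).
by rewrite (@hpart_rec_fuel N (N.+1 - w i))//; have := w_gt0 i; lia.
Qed.

Lemma hpart_euler N f x : N%:R * hpart N f x =
  \sum_(i | (w i <= N)%N) (w i)%:R * x 0 i * hpart (N - w i) (partial i f) x.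
Proof.
case: N => [|N].
  by rewrite mul0r big_pred0// => i; have := w_gt0 i; lia.
by rewrite hpart_pos// mulrA mulfV ?mul1r// pnatr_eq0.
Qed.

Lemma hpart_smooth N f : smooth_on setT (hpart N f).
Proof.
elim/ltn_ind: N f => -[|N] IH f; first exact: smooth_cst.
rewrite hpart_pos//; apply: (smoothM openT (smooth_cst _)).
apply: (smooth_sum _ openT) => i _; apply: (smoothM openT).
  exact: (smoothM openT (smooth_cst _) (smooth_coord i)).
by apply: IH; have := w_gt0 i; lia.
Qed.

Lemma hpart_dil N f t x : hpart N f (dil w t x) = t ^+ N * hpart N f x.
Proof.
elim/ltn_ind: N f => -[|N] IH f; first by rewrite expr0 mul1r.
rewrite hpart_pos// mulrCA; congr (_ * _); rewrite mulr_sumr.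
apply: eq_bigr => i wi; rewrite IH; last by have := w_gt0 i; lia.
rewrite mxE; have -> : t ^+ N.+1 = t ^+ w i * t ^+ (N.+1 - w i).
  by rewrite -exprD subnKC.
by ring.
Qed.

Variables (U : set 'rV[R]_n) (oU : open U) (U0 : U 0).

(** Only derivatives at 0 enter [hpart]. This transfers the symmetry of second derivatives, known on
    [U], to homogeneous parts on all of R^n. *)
Lemma hpart_eq_on N f g : eq_on U f g -> hpart N f = hpart N g.
Proof.
elim/ltn_ind: N f g => -[|N] IH f g fg.
  by rewrite !hpart0; apply/funext => x; exact: fg.
rewrite !hpart_pos//; apply/funext => x; congr (_ * _); apply: eq_bigr => i wi.
rewrite (IH _ _ (partial i f) (partial i g))//; first by have := w_gt0 i; lia.
exact: partial_eq_on.
Qed.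

(** Differentiating Euler's identity for [f_N] in [x_j] gives [w_j (\partial_j f)_(N - w_j)] plus a
    sum which, by induction and symmetry of second derivatives, is Euler's sum for the same
    function, that is [N - w_j] times it. The factors add up to [N]. *)
Lemma hpart_partial N f j : smooth_on U f ->
  partial j (hpart N f)
  = if (w j <= N)%N then hpart (N - w j) (partial j f) else fun=> 0.
Proof.
elim/ltn_ind: N f => -[|N] IH f sf; apply/funext => x.
  by rewrite hpart0 partial_cst ltn_geF.
pose A i := (w i <= N.+1)%N.
pose T i : F := fun x => (w i)%:R * x 0 i * hpart (N.+1 - w i) (partial i f) x.
have sX i : smooth_on setT (fun x : 'rV[R]_n => (w i)%:R * x 0 i).
  exact: (smoothM openT (smooth_cst _) (smooth_coord i)).
have sT i : smooth_on setT (T i) by apply: (smoothM openT) => //; exact: hpart_smooth.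
have dT i : A i -> partial j (T i) x
    = (if i == j then (w j)%:R * hpart (N.+1 - w j) (partial j f) x else 0)
      + (w i)%:R * x 0 i * (if (w j <= N.+1 - w i)%N
        then hpart (N.+1 - w i - w j) (partial j (partial i f)) x else 0).
  move=> Ai; have dc := differentiable_cst ((w i)%:R : R) x.
  have sh := hpart_smooth (N.+1 - w i) (partial i f).
  have := partialM j (smooth_diff (sX i) I) (smooth_diff sh I).
  rewrite -/(T i) => ->; rewrite (partialM j dc (differentiable_coord x 0 i)).
  rewrite partial_cst mul0r add0r partial_coord eq_sym IH; last 2 first.
  - by have := w_gt0 i; rewrite /A in Ai; lia.
  - exact: smooth_partial.
  congr (_ + _ * _); last by case: ifP.
  by have [->|_] := eqVneq i j; [rewrite mulr1|rewrite mulr0 mul0r].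
rewrite hpart_pos//.
have -> : partial j (fun x => N.+1%:R^-1 * \sum_(i | A i) T i x) x
    = N.+1%:R^-1 * \sum_(i | A i) partial j (T i) x.
  have := iter_partialZ [:: j] N.+1%:R^-1 openT
    (smooth_sum (index_enum _) openT (fun i (_ : A i) => sT i)) (x := x) I => /= ->.
  by rewrite partial_sum// => i _; exact: smooth_diff (sT i) I.
rewrite (eq_bigr _ dT) big_split /=.
(* If [w j] exceeds the degree, every term vanishes. *)
have [wj|wj] := leqP (w j) N.+1; last first.
  rewrite [X in _ * (X + _)]big1 ?add0r => [|i Ai]; last first.
    by case: eqP => // ij; exfalso; rewrite /A ij in Ai; lia.
  rewrite big1 ?mulr0// => i Ai.
  have -> : (w j <= N.+1 - w i)%N = false by lia.
  by rewrite mulr0.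
rewrite (bigD1 j)//= eqxx [X in _ + X + _]big1 ?addr0; last first.
  by move=> i /andP[_ /negbTE ->].
apply: (mulfI (_ : N.+1%:R != 0 :> R)); first by rewrite pnatr_eq0.
rewrite mulrA mulfV ?mul1r ?pnatr_eq0//.
have -> : N.+1%:R * hpart (N.+1 - w j) (partial j f) x
    = (w j)%:R * hpart (N.+1 - w j) (partial j f) x
      + (N.+1 - w j)%:R * hpart (N.+1 - w j) (partial j f) x.
  by rewrite -mulrDl -natrD subnKC.
congr (_ + _); rewrite hpart_euler big_mkcond [RHS]big_mkcond.
apply: eq_bigr => i _; rewrite /A.
have -> : (w i <= N.+1 - w j)%N = (w i <= N.+1)%N && (w j <= N.+1 - w i)%N by lia.
case: ifP => //= _; case: ifP => _; last by rewrite mulr0.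
have E : eq_on U (partial j (partial i f)) (partial i (partial j f)).
  by move=> y Uy; exact: (partial_partial j i oU sf Uy).
rewrite (subnAC N.+1 (w i) (w j)).
have H := hpart_eq_on (N.+1 - w j - w i) E.
exact: (congr1 (fun h => (w i)%:R * x 0 i * h x) H).
Qed.

Lemma hpart_iter N f I : smooth_on U f ->
  dI I (hpart N f) = if (seq_weight w I <= N)%N
    then hpart (N - seq_weight w I) (dI I f) else fun=> 0.
Proof.
move=> sf; elim: I => [|i I IH] /=; first by rewrite /seq_weight big_nil subn0.
rewrite IH seq_weight_cons; case: leqP => IN; last first.
  rewrite leqNgt (leq_trans IN) ?leq_addl//=.
  by apply/funext => x; rewrite partial_cst.
rewrite (hpart_partial _ _ (smooth_iter I sf)).
rewrite addnC subnDA; case: ifP => h; case: ifP => //; lia.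
Qed.

End HomogeneousPart.

(** * Expansion of a function along the dilations *)

Section Asymptotics.
Variables (R : realType) (n : nat) (w : 'I_n -> nat).
Hypothesis w_gt0 : forall i, (0 < w i)%N.
Local Notation F := ('rV[R]_n -> R).
Local Notation dI := (iter_seq (@partial R n)).
Local Notation ord := (ord_ge (@partial R n) w).
Variables (U : set 'rV[R]_n) (oU : open U) (U0 : U 0).

Lemma near_dil (P : set 'rV[R]_n) (B : R) : 0 < B -> nbhs (0 : 'rV[R]_n) P ->
  \forall t \near (0 : R), forall x, `|x| <= B -> P (dil w t x).
Proof.
move=> B0 /nbhs_ballP[e /= e0 eP].
apply/nbhs_ballP; exists (Num.min 1 (e / B)) => /=.
  by rewrite lt_min ltr01 divr_gt0.
move=> t; rewrite -ball_normE /= sub0r normrN lt_min => /andP[t1 tB] x xB.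
apply: eP; rewrite -ball_normE /= sub0r normrN.
apply: le_lt_trans (norm_dil (ltW t1) w_gt0 xB) _.
by rewrite -ltr_pdivlMr.
Qed.

Lemma bounded_dil (f : F) (B : R) : 0 < B -> smooth_on U f ->
  exists C, \forall t \near (0 : R), forall x, `|x| <= B ->
    U (dil w t x) /\ `|f (dil w t x)| <= C.
Proof.
move=> B0 sf; exists (`|f 0| + 1).
apply: (near_dil (P := fun y => U y /\ `|f y| <= `|f 0| + 1) B0).
have nU : nbhs (0 : 'rV[R]_n) U by exact: open_nbhs_nbhs.
have /cvgrPdist_lt /(_ _ ltr01) cf := differentiable_continuous (smooth_diff sf U0).
near=> y; split; first by near: y.
rewrite -[f y](subrK (f 0)) addrC (le_trans (ler_normD _ _))// lerD2l distrC ltW//.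
by near: y.
Unshelve. all: by end_near. Qed.

Lemma is_derive_monomial k (c s : R) :
  is_derive s (1 : R) (fun r : R => r ^+ k * c) (k%:R * s ^+ k.-1 * c).
Proof.
have de : derivable (fun r : R => r ^+ k) s 1 by exact: exprn_derivable.
have dc : derivable (cst c : R -> R) s 1 by exact: derivable_cst.
apply: DeriveDef; first exact: (derivableM de dc).
rewrite (deriveM de dc) derive_cst scaler0 add0r exp_derive /=.
by rewrite /GRing.scale /= mulr1 mulrC.
Qed.

Lemma is_derive_dil (f : F) (x : 'rV[R]_n) (s : R) :
  differentiable f (dil w s x) ->
  is_derive s (1 : R) (fun r => f (dil w r x))
    (\sum_i (w i)%:R * s ^+ (w i).-1 * x 0 i * partial i f (dil w s x)).
Proof.
move=> df; have dk k : is_derive s (1 : R) (fun r => dil w r x 0 k)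
    ((w k)%:R * s ^+ (w k).-1 * x 0 k).
  have -> : (fun r => dil w r x 0 k) = fun r => r ^+ w k * x 0 k.
    by apply/funext => r; rewrite mxE.
  exact: is_derive_monomial.
have dk' k : differentiable (fun r => dil w r x 0 k) s.
  by have [? _] := dk k; exact/derivable1_diffP.
apply: DeriveDef.
  apply: diff_derivable; apply: (differentiable_comp (f := fun r => dil w r x)) => //.
  exact: differentiable_row.
rewrite (derive_comp_row (f := fun r => dil w r x))//.
by apply: eq_bigr => i _; have [_ ->] := dk i.
Qed.

(* The [t]-derivative of [f (dil t x) - t ^ N * f_N(x)] is the combination of
   the same differences for the [\partial_i f], of weight [N - w_i], so the
   estimate follows by induction on [N] from the mean value theorem in [t]. *)
Lemma dil_expansion N (f : F) (B : R) : 0 < B -> smooth_on U f -> ord f N ->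
  exists C, \forall t \near (0 : R), forall x, `|x| <= B ->
    `|f (dil w t x) - t ^+ N * hpart w N f x| <= C * `|t| ^+ N.+1.
Proof.
move=> B0; elim/ltn_ind: N f => N IH f sf fN.
(* The factor of [w_i x_i] in the [t]-derivative. It is O(t^N): by induction if [w i <= N], the
   exponents being [(w i - 1) + (N - w i + 1)], and otherwise by boundedness, as [w i - 1 >= N]. *)
pose e i t x := t ^+ (w i).-1 * (partial i f (dil w t x)
  - if (w i <= N)%N then t ^+ (N - w i) * hpart w (N - w i) (partial i f) x else 0).
have near1 : \forall t \near (0 : R), `|t| <= 1.
  exact: nbhs0_le.
have /choice[C hC] : forall i, exists c, \forall t \near (0 : R),
    forall x, `|x| <= B -> `|e i t x| <= c * `|t| ^+ N.
  move=> i.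
  have wi := w_gt0 i; rewrite /e; case: leqP => wN.
    have wN' : (N - w i < N)%N by lia.
    have [c hc] := IH _ wN' _ (smooth_partial i sf) (ord_der (i := i) fN).
    exists c; near=> t => x xB; rewrite normrM normrX.
    have -> : `|t| ^+ N = `|t| ^+ (w i).-1 * `|t| ^+ (N - w i).+1.
      by rewrite -exprD; congr (_ ^+ _); lia.
    by rewrite mulrCA ler_wpM2l ?exprn_ge0//; move: x xB; near: t.
  have [c hc] := bounded_dil B0 (smooth_partial i sf).
  exists c; near=> t => x xB; rewrite subr0 normrM normrX mulrC.
  have [] : U (dil w t x) /\ `|partial i f (dil w t x)| <= c.
    by move: x xB; near: t.
  move=> _ fc; apply: ler_pM => //.
  have wN' : (N <= (w i).-1)%N by lia.
  by apply: ler_wiXn2l => //; near: t.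
(* [B] bounds the [x_i]; the absolute value is there because the sign of [C i] is unknown. *)
exists (\sum_i (w i)%:R * B * `|C i|).
have [c hc] := bounded_dil B0 sf.
have hCa : \forall t \near (0 : R), forall i x, `|x| <= B ->
    `|e i t x| <= C i * `|t| ^+ N.
  exact: filter_forall hC.
have : nbhs (0 : R) (fun t => (forall x, `|x| <= B ->
      U (dil w t x) /\ `|f (dil w t x)| <= c) /\
    (forall i x, `|x| <= B -> `|e i t x| <= C i * `|t| ^+ N)).
  exact: filterI hc hCa.
(* A ball is needed: the estimates are used at the intermediate points [s] with [|s| <= |t|]. *)
move=> /nbhs_ballP[d /= d0 hd].
near=> t => x xB.
have td : `|t| < d.
  by near: t; exists d => // y; rewrite /ball_ /= sub0r normrN.
pose phi s := f (dil w s x) - s ^+ N * hpart w N f x.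
have dphi s : `|s| <= `|t| -> is_derive s (1 : R) phi
    (\sum_i (w i)%:R * x 0 i * e i s x).
  move=> st; have : ball 0 d s.
    by rewrite -ball_normE /= sub0r normrN (le_lt_trans st).
  move=> /hd[/(_ x xB)[Us _] _].
  have [d1 E1] := is_derive_dil (smooth_diff sf Us).
  have [d2 E2] := is_derive_monomial N (hpart w N f x) s.
  apply: DeriveDef; first exact: (derivableB d1 d2).
  rewrite (deriveB d1 d2) E1 E2.
  rewrite [X in _ - X]mulrAC hpart_euler// mulr_suml.
  rewrite [X in _ - X]big_mkcond -sumrB.
  apply: eq_bigr => i _; rewrite /e.
  case: ifP => [wi|_]; last by ring.
  have -> : s ^+ N.-1 = s ^+ (w i).-1 * s ^+ (N - w i).
    by rewrite -exprD; congr (_ ^+ _); have := w_gt0 i; lia.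
  ring.
have phi0 : phi 0 = 0.
  rewrite /phi; have -> : dil w 0 x = 0.
    apply/rowP => k; rewrite !mxE expr0n; have := w_gt0 k.
    by case: (w k) => // *; rewrite mul0r.
  case: (posnP N) => [->|N0]; first by rewrite expr0 mul1r hpart0 subrr.
  by rewrite expr0n gtn_eqF// mul0r subr0 (ord_val fN).
have [s st] := mvt_from0 dphi; rewrite phi0 subr0 -/(phi t) => ->.
rewrite normrM exprS mulrCA ler_wpM2l//.
apply: le_trans (ler_norm_sum _ _ _) _; rewrite mulr_suml; apply: ler_sum => i _.
have sd : ball 0 d s by rewrite -ball_normE /= sub0r normrN (le_lt_trans st).
have [_ /(_ i x xB) es] := hd s sd.
rewrite 2!normrM ger0_norm ?ler0n// -!mulrA ler_wpM2l ?ler0n//.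
apply: ler_pM => //; first exact: le_trans (norm_coord_le _ _) xB.
apply: le_trans es _; apply: le_trans (ler_wpM2r _ (ler_norm _)) _.
  by rewrite exprn_ge0.
by apply: ler_wpM2l => //; apply: lerXn2r; rewrite ?nnegrE.
Unshelve. all: by end_near. Qed.

End Asymptotics.

Lemma scale_sub_coord (R : realType) n (c : R) (x y : 'rV[R]_n) k :
  (c *: x - y) 0 k = c * x 0 k - y 0 k.
Proof. by rewrite !mxE. Qed.

(** * Asymptotics of the rescaled frame *)

Section BigO.
Variables (R : realType) (n : nat) (w : 'I_n -> nat).
Hypothesis w_gt0 : forall i, (0 < w i)%N.
Local Notation F := ('rV[R]_n -> R).
Local Notation dI := (iter_seq (@partial R n)).
Local Notation ord := (ord_ge (@partial R n) w).
Variables (U : set 'rV[R]_n) (oU : open U) (U0 : U 0).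

(* The limit of [t ^ (a - b) * f (dil t x)] as t -> 0, for [f] of weight at
   least [b - a]. *)
Definition model (a b : nat) (f : F) : F :=
  if (a <= b)%N then hpart w (b - a) f else fun=> 0.

Lemma model_smooth a b f : smooth_on setT (model a b f).
Proof.
by rewrite /model; case: ifP => _; [exact: hpart_smooth|exact: smooth_cst].
Qed.

Lemma model_dil a b f t x : t != 0 ->
  model a b f (dil w t x) * t^-1 ^+ b = t ^- a * model a b f x.
Proof.
move=> t0; rewrite /model; case: leqP => ab; last by rewrite mul0r mulr0.
rewrite hpart_dil// exprVn.
have -> : t ^+ b = t ^+ (b - a) * t ^+ a by rewrite -exprD subnK.
by field; rewrite !expf_neq0.
Qed.

Lemma iter_partial0 I : dI I (fun=> 0) = fun=> 0.
Proof.
by elim: I => //= i I ->; apply/funext => x; rewrite partial_cst.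
Qed.

(** If [a + <I> <= b], the derivative of the model is the part of [\partial_I f] of degree
    [b - a - <I>], and [dil_expansion] divided by that power of [t] leaves O(t). Otherwise the
    derivative of the model is 0, and a positive power of [t] multiplies a bounded function. *)
Lemma model_bigO (f : F) a b (K : set 'rV[R]_n) I : smooth_on U f ->
  ord f (b - a) -> compact K -> exists C, \forall t \near (0 : R)^', forall x, K x ->
  `|dI I (fun y => t ^+ a * (f (dil w t y) * t^-1 ^+ b) - model a b f y) x|
    <= C * `|t|.
Proof.
move=> sf fN cK.
have [B B0 KB] : exists2 B : R, 0 < B & forall x, K x -> `|x| <= B.
  have [M [_ hM]] := compact_bounded cK.
  exists (Num.max 1 (M + 1)); first by rewrite lt_max ltr01.
  by apply: hM; rewrite lt_max ltrDl ltr01 orbT.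
have sI := smooth_iter I sf.
have [c0 hc0] := bounded_dil w_gt0 oU U0 B0 sI.
have oI := ord_iter (I := I) fN.
have [c1 hc1] := dil_expansion w_gt0 oU U0 B0 sI oI.
have near1 : \forall t \near (0 : R), `|t| <= 1 by exact: nbhs0_le.
have [ab|ab] := boolP ((a <= b) && (seq_weight w I <= b - a))%N.
  move: ab => /andP[ab Ib]; exists c1; near=> t => x /KB xB.
  have t0 : t != 0 by near: t; exact: nbhs_dnbhs_neq.
  have [Ux _] : U (dil w t x) /\ `|dI I f (dil w t x)| <= c0.
    by move: x xB; near: t; exact: nbhs_dnbhs hc0.
  rewrite (iter_rescaled oU a b I sf (model_smooth a b f) Ux) /model ab.
  rewrite (hpart_iter w_gt0 oU U0 (b - a) I sf) Ib.
  pose M := (b - a - seq_weight w I)%N.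
  have bE : b = (a + seq_weight w I + M)%N by rewrite /M; lia.
  have -> : t ^+ (a + seq_weight w I) / t ^+ b = t ^- M.
    have -> : t ^+ b = t ^+ (a + seq_weight w I) * t ^+ M by rewrite -exprD -bE.
    by rewrite invfM mulrA mulfV ?mul1r// expf_neq0.
  rewrite -/M -[hpart w M (dI I f) x](mulKf (expf_neq0 M t0)) -mulrBr normrM.
  rewrite normfV normrX ler_pdivrMl ?exprn_gt0 ?normr_gt0// mulrCA -exprSr.
  by move: x xB {Ux}; near: t; exact: nbhs_dnbhs hc1.
exists c0; near=> t => x /KB xB.
have t0 : t != 0 by near: t; exact: nbhs_dnbhs_neq.
have t1 : `|t| <= 1 by near: t; exact: nbhs_dnbhs near1.
have [Ux fc] : U (dil w t x) /\ `|dI I f (dil w t x)| <= c0.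
  by move: x xB; near: t; exact: nbhs_dnbhs hc0.
rewrite (iter_rescaled oU a b I sf (model_smooth a b f) Ux).
have -> : dI I (model a b f) x = 0.
  move: ab; rewrite /model; case: leqP => //= ab => [Ib|_].
    by rewrite (hpart_iter w_gt0 oU U0 (b - a) I sf) (negbTE Ib).
  by rewrite iter_partial0.
have h : (b < a + seq_weight w I)%N.
  by move: ab; rewrite negb_and -!ltnNge => /orP[|]; lia.
have -> : t ^+ (a + seq_weight w I) / t ^+ b = t ^+ (a + seq_weight w I - b).
  by rewrite -[in LHS](subnK (ltnW h)) exprD mulfK// expf_neq0.
rewrite subr0 normrM mulrC; apply: ler_pM => //.
by rewrite normrX -[leRHS]expr1 ler_wiXn2l//; lia.
Unshelve. all: by end_near. Qed.

(** At the fixed point 0 of the dilations, the derivative is a constant plus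
    [t^(a + <al> - b) * \partial^al f(0)]. A negative exponent makes this unbounded unless
    [\partial^al f(0) = 0]. *)
Lemma ord_of_bigO (f g : F) a b : smooth_on U f -> smooth_on setT g ->
  (forall al : multi n, exists C, \forall t \near (0 : R)^',
  `|iter_multi (@partial R n) al
     (fun y => t ^+ a * (f (dil w t y) * t^-1 ^+ b) - g y) 0| <= C * `|t|) ->
  ord f (b - a).
Proof.
move=> sf sg h; apply/(weight_geP w oU U0 a b sf) => al.
rewrite -seq_weight_word iter_multi_word => lt_ab.
have [C hC] := h al; set I := word al in lt_ab *.
have Ib : (a + seq_weight w I < b)%N by lia.
(* [D] bounds the singular term for [|t| <= 1], whence [|c| <= D * |t|]; this fails once
   [|t| < |c| / (D + 1)], where the 1 keeps the denominator positive. *)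
pose c := dI I f 0; pose D := `|dI I g 0| + `|C|.
apply/eqP/negPn/negP => c0.
suff : \forall t \near (0 : R)^', False by move=> /filter_ex[].
have near1 : \forall t \near (0 : R), `|t| <= 1 by exact: nbhs0_le.
have D0 : 0 < D + 1 by rewrite ltr_wpDl// addr_ge0.
near=> t.
have t0 : t != 0 by near: t; exact: nbhs_dnbhs_neq.
have t1 : `|t| <= 1 by near: t; exact: nbhs_dnbhs near1.
have tc : `|t| < `|c| / (D + 1).
  by near: t; apply: dnbhs0_lt; rewrite divr_gt0// normr_gt0.
have : `|iter_multi (@partial R n) al
     (fun y => t ^+ a * (f (dil w t y) * t^-1 ^+ b) - g y) 0| <= C * `|t|.
  by near: t.
have Ud : U (dil w t 0) by rewrite dil0.
rewrite iter_multi_word (iter_rescaled oU a b I sf sg Ud) dil0 -/c.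
have -> : t ^+ (a + seq_weight w I) / t ^+ b = t ^- (b - (a + seq_weight w I)).
  have -> : t ^+ b = t ^+ (a + seq_weight w I) * t ^+ (b - (a + seq_weight w I)).
    by rewrite -exprD subnKC// ltnW.
  by rewrite invfM mulrA mulfV ?mul1r// expf_neq0.
move=> hle; have : `|c| <= D * `|t|.
  have cE : `|t ^- (b - (a + seq_weight w I)) * c| <= D.
    rewrite -[_ * c](subrK (dI I g 0)) (le_trans (ler_normD _ _))// addrC lerD2l.
    apply: le_trans hle _; apply: le_trans (ler_norm _) _.
    by rewrite normrM normr_id ler_piMr.
  move: cE; rewrite normrM normfV normrX ler_pdivrMl ?exprn_gt0 ?normr_gt0// => cE.
  apply: le_trans cE _; rewrite mulrC; apply: ler_wpM2l.
    by rewrite addr_ge0.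
  by rewrite -[leRHS]expr1 ler_wiXn2l//; lia.
apply/negP; rewrite -ltNge.
rewrite (@le_lt_trans _ _ ((D + 1) * `|t|))//.
  by rewrite ler_wpM2r// lerDl.
by rewrite mulrC -ltr_pdivlMr.
Unshelve. all: by end_near. Qed.

Variable Y : 'I_n -> 'rV[R]_n -> 'rV[R]_n.
Hypothesis sY : forall j, smooth_map U (Y j).

Lemma rescaled_bigO j : (forall k, ord (fun x => Y j x 0 k) (w k - w j)) ->
  exists Xa : 'rV[R]_n -> 'rV[R]_n,
    [/\ smooth_map setT Xa, homogeneous w (vf_op Xa) (- (w j)%:Z)
      & vf_bigO U (fun t x => t ^+ w j *: pull_vf w t (Y j) x - Xa x)].
Proof.
move=> oY; pose m k := model (w j) (w k) (fun x => Y j x 0 k).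
pose Xa x : 'rV[R]_n := \row_k m k x.
have XaE k : (fun x => Xa x 0 k) = m k by apply/funext => x; rewrite mxE.
exists Xa; split.
- by move=> k; rewrite XaE; exact: model_smooth.
- move=> t t0 u su x; rewrite /pull_op /vf_op mulr_sumr; apply: eq_bigr => k _.
  have dk : differentiable u (dil w t^-1 (dil w t x)) by exact: (smooth_diff su).
  rewrite (partial_comp_dil k dk) dilK// mulrA [Xa _ 0 k]mxE model_dil//.
  by rewrite [Xa x 0 k]mxE -mulrA -exprnN.
- move=> K cK KU al k.
  have [C hC] := model_bigO (word al) (sY j k) (@oY k) cK.
  exists C; apply: filterS hC => t ht x Kx; rewrite iter_multi_word.
  have -> : (fun y => (t ^+ w j *: pull_vf w t (Y j) y - Xa y) 0 k)
    = (fun y => t ^+ w j * (Y j (dil w t y) 0 k * t^-1 ^+ w k) - m k y).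
    by apply/funext => y; rewrite scale_sub_coord pull_vfE [Xa y 0 k]mxE.
  exact: ht.
Qed.

Lemma ord_of_rescaled_bigO j (Xa : 'rV[R]_n -> 'rV[R]_n) : smooth_map setT Xa ->
  vf_bigO U (fun t x => t ^+ w j *: pull_vf w t (Y j) x - Xa x) ->
  forall k, ord (fun x => Y j x 0 k) (w k - w j).
Proof.
move=> sXa hO k; apply: (@ord_of_bigO _ (fun x => Xa x 0 k)) => //.
  exact: (sY j k).
move=> al; have [||C hC] := hO [set 0] _ _ al k; first exact: compact_set1.
  by move=> _ ->.
exists C; apply: filterS hC => t /(_ 0 erefl).
have -> // : (fun y => (t ^+ w j *: pull_vf w t (Y j) y - Xa y) 0 k)
  = (fun y => t ^+ w j * (Y j (dil w t y) 0 k * t^-1 ^+ w k) - Xa y 0 k).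
by apply/funext => y; rewrite scale_sub_coord pull_vfE.
Qed.

End BigO.

(** * Passing from the manifold to the coordinates *)

Section Manifold.
Variables (R : realType) (n : nat) (M : topologicalType) (S : manifold R n M).
Implicit Types (c d : chart R n M) (X : M -> 'rV[R]_n).

Lemma open_chart_image c (A : set M) : open A -> open (c @` (dom c `&` A)).
Proof.
move=> oA; have -> : c @` (dom c `&` A) = rng c `&` bwd c @^-1` A.
  apply/seteqP; split=> [_ [p [cp Ap] <-]|x [cx Ax]].
    by split; [exact: fwd_rng|rewrite /= fwdK].
  by exists (bwd c x); [split=> //; exact: bwd_dom|exact: bwdK].
rewrite openE => x [cx Ax]; apply: filterI.
  by apply: open_nbhs_nbhs; split=> //; exact: rng_open.
by apply: (bwd_continuous cx); exact: open_nbhs_nbhs.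
Qed.

(** [vder] is computed in the chart chosen at [p]; the chain rule through the transition map
    [c \o bwd d] moves the computation to [c]. *)
Lemma vder_chart c X (V : normedModType R) (g : M -> V) p :
  compatible c (chart_at S p) -> dom c p ->
  differentiable (g \o bwd c) (c p) ->
  vder S X g p = 'D_(vder S X c p) (g \o bwd c) (c p).
Proof.
move=> [_ scd] cp dg; set d := chart_at S p in scd.
have dp : dom d p by exact: chart_at_dom.
have dpsi : differentiable (c \o bwd d) (d p).
  by apply: differentiable_row => k; apply: (smooth_diff (scd k)); exists p.
have cpE : (c \o bwd d) (d p) = c p by rewrite /= fwdK.
rewrite -cpE in dg; rewrite {1 2}/vder -/d -cpE -derive_comp//.
apply: near_eq_derive.
have oW : open (d @` (dom d `&` dom c)) by apply: open_chart_image; exact: dom_open.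
have Wp : (d @` (dom d `&` dom c)) (d p) by exists p.
near=> y; have [q [dq cq] <-] : (d @` (dom d `&` dom c)) y.
  by near: y; exact: open_nbhs_nbhs.
by rewrite /= fwdK// fwdK.
Unshelve. all: by end_near. Qed.

Variable phi : chart R n M.
Hypothesis phi_coord : local_coordinates S phi.
Local Notation U := (rng phi).

Lemma vder_vf_op X (g : M -> R) p : dom phi p ->
  differentiable (g \o bwd phi) (phi p) ->
  vder S X g p = vf_op (vf_in S phi X) (g \o bwd phi) (phi p).
Proof.
move=> pp dg; rewrite (vder_chart X (phi_coord (chart_at_atlas S p)) pp dg).
by rewrite (derive_partial _ dg) /vf_op /vf_in fwdK.
Qed.

(** [smooth_vf] speaks of the charts of the atlas, with which [phi] is only compatible. Near each
    point the coefficients in [phi] are those in an atlas chart, multiplied by the Jacobian matrix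
    of the transition map (the function [h]) and read back in [phi]. *)
Lemma smooth_vf_in X : smooth_vf S (dom phi) X -> smooth_map U (vf_in S phi X).
Proof.
move=> sX k I x0 Ux0; set p0 := bwd phi x0; set c := chart_at S p0.
have ac : atlas S c by exact: chart_at_atlas.
have [spc scp] := phi_coord ac; rewrite setIC in scp.
set V := phi @` (dom phi `&` dom c) in spc; set W := c @` (dom c `&` dom phi) in scp.
have oV : open V by apply: open_chart_image; exact: dom_open.
have oW : open W by apply: open_chart_image; exact: dom_open.
have Vx0 : V x0.
  exists p0; last exact: bwdK.
  by split; [exact: bwd_dom|exact: chart_at_dom].
pose h y := \sum_l vf_in S c X y 0 l * partial l (fun y => (phi \o bwd c) y 0 k) y.
have sh : smooth_on W h.
  apply: smooth_sum => // l _; apply: smoothM => //; first exact: (sX c ac l).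
  exact: smooth_partial (scp k).
have VW x : V x -> W ((c \o bwd phi) x).
  by move=> [q [pq cq] <-]; exists q => //=; rewrite fwdK.
suff E : eq_on V (h \o (c \o bwd phi)) (fun x => vf_in S phi X x 0 k).
  exact: (smooth_eq_on oV E (smooth_comp oV spc VW sh)).
move=> _ [p [pp cp] <-]; rewrite /= fwdK//.
have dphi : differentiable (phi \o bwd c) (c p).
  by apply: differentiable_row => l; apply: (smooth_diff (scp l)); exists p.
have -> : vf_in S phi X (phi p) = vder S X phi p by rewrite /vf_in fwdK.
rewrite (vder_chart X (atlas_compatible ac (chart_at_atlas S p)) cp dphi).
rewrite derive_row// derive_partial; last by apply: (smooth_diff (scp k)); exists p.
by apply: eq_bigr => l _; rewrite /vf_in fwdK.
Qed.

Variable X : 'I_n -> M -> 'rV[R]_n.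
Hypothesis sX : forall j, smooth_vf S (dom phi) (X j).
Local Notation Y := (fun j => vf_in S phi (X j)).

Lemma iter_vder I (f : M -> R) p : smooth_on U (f \o bwd phi) -> dom phi p ->
  iter_seq (fun i => vder S (X i)) I f p
  = iter_seq (fun i => vf_op (Y i)) I (f \o bwd phi) (phi p).
Proof.
move=> sf; elim: I p => [|i I IH] p pp /=; first by rewrite fwdK.
have oU := rng_open (c := phi).
have hdY j := derivation_vf_op oU (smooth_vf_in (sX j)).
have sG := der_iter_smooth hdY I sf.
have E : eq_on U (iter_seq (fun i => vf_op (Y i)) I (f \o bwd phi))
    (iter_seq (fun i => vder S (X i)) I f \o bwd phi).
  by move=> x Ux; rewrite /= IH ?bwdK//; exact: bwd_dom.
have Up := fwd_rng pp.
rewrite vder_vf_op//; last exact: (differentiable_eq_on oU Up E (smooth_diff sG Up)).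
by rewrite (der_eq_on (hdY i) E Up).
Qed.

Lemma iter_vder_coord a k I : centered_at phi a ->
  iter_seq (fun i => vder S (X i)) I (fun p => phi p 0 k) a
  = iter_seq (fun i => vf_op (Y i)) I (fun x => x 0 k) 0.
Proof.
move=> [pa pa0]; have oU := rng_open (c := phi).
have hdY j := derivation_vf_op oU (smooth_vf_in (sX j)).
have E : eq_on U (fun x => x 0 k) ((fun p => phi p 0 k) \o bwd phi).
  by move=> x Ux /=; rewrite bwdK.
have U0 : U 0 by rewrite -pa0; exact: fwd_rng.
rewrite iter_vder//; last exact: (smooth_eq_on oU E (smooth_coord k)).
by rewrite pa0 (der_iter_eq_on hdY I E U0).
Qed.

End Manifold.

Theorem theorem5p6 (R : realType) (n : nat) (M : topologicalType)
    (S : manifold R n M) (r : nat) (H : carnot S r) (a : M)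
    (phi : chart R n M) (X : 'I_n -> M -> 'rV[R]_n) :
  local_coordinates S phi ->
  centered_at phi a ->
  H_frame H (dom phi) X ->
  linearly_adapted S phi X ->
  let w := weight_seq H in
  let U := rng phi in
  let Y := fun j => vf_in S phi (X j) in
  [<-> (* (i) *)
       privileged S w phi a X;
       (* (ii) *)
       forall j, exists Xa : 'rV[R]_n -> 'rV[R]_n,
         [/\ smooth_map setT Xa,
             homogeneous w (vf_op Xa) (- (w j)%:Z)
           & vf_bigO U (fun t x => t ^+ w j *: pull_vf w t (Y j) x - Xa x)];
       (* (iii) *)
       forall j, diffop_weight w U (vf_op (Y j)) (- (w j)%:Z);
       (* (iv) *)
       forall al : multi n,
         diffop_weight w U (iter_multi (fun j => vf_op (Y j)) al)
           (- (multi_weight w al)%:Z)].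
Proof.
move=> hphi ca [hX _] Y0 w U Y.
(* [weight_seq] is a successor by definition. *)
have w_gt0 i : (0 < w i)%N by [].
have oU : open U := rng_open (c := phi).
have U0 : U 0 by case: ca => pa <-; exact: fwd_rng.
have sX j : smooth_vf S (dom phi) (X j) by have [] := hX j.
have sY j : smooth_map U (Y j) by exact: smooth_vf_in.
have singleE j : seq_weight w [:: j] = w j by rewrite /seq_weight big_seq1.
(* The cycle (i), (ii), (iii), (iv), (i); every implication passes through the bound [w k - w j] on
   the weights of the coefficients. *)
tfae => [[_ hi]|hii|hiii|hiv].
- have oX k : ord_ge (fun j => vf_op (Y j)) w (fun x => x 0 k) (w k).
    by move=> I; rewrite -(iter_vder_coord hphi sX k I ca); have [h _] := hi k; exact: h.
  by move=> j; apply: (rescaled_bigO w_gt0 oU U0 sY) => k;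
    exact: (coeff_ord_of_order w_gt0 oU U0 sY Y0 oX).
- have oY j k : ord_ge (@partial R n) w (fun x => Y j x 0 k) (w k - w j).
    have [Xa [sXa _ hO]] := hii j; exact: (ord_of_rescaled_bigO oU U0 sY sXa hO).
  move=> j; rewrite -singleE; exact: (monomial_weight oU U0 sY Y0 oY [:: j]).
- have oY := coeff_ord_of_weight oU U0 hiii.
  move=> al; rewrite -seq_weight_word.
  have -> : iter_multi (fun j => vf_op (Y j)) al
      = iter_seq (fun j => vf_op (Y j)) (word al).
    by apply/funext => u; rewrite iter_multi_word.
  exact: (monomial_weight oU U0 sY Y0 oY).
(* (iv) for the multi-order of the one-letter word [[:: j]] is (iii). *)
- have hiii j : diffop_weight w U (vf_op (Y j)) (- (w j)%:Z).
    have E : word (mult [:: j]) = [:: j] by apply: perm_small_eq => //; exact: perm_word.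
    have := hiv (mult [:: j]); rewrite -seq_weight_word E singleE.
    have -> // : iter_multi (fun j => vf_op (Y j)) (mult [:: j]) = vf_op (Y j).
    by apply/funext => u; rewrite iter_multi_word E.
  have oX := coord_order_of_ord oU U0 sY (coeff_ord_of_weight oU U0 hiii).
  split=> // k; split=> [I hI|].
    by rewrite (iter_vder_coord hphi sX k I ca); exact: oX.
  (* The order is exactly [w k]: linear adaptedness gives [X_k x_k = 1] at the centre. *)
  exists [:: k] => //; rewrite (iter_vder_coord hphi sX k [:: k] ca) /=.
  by rewrite vf_op_coord (Y0 k) mxE !eqxx oner_neq0.
Qed.
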